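(* Consider the sparse signal in noise model: $S\in\{1,\dots,N\}$, $\mathcal{X}_S=\{\mathbf{x}\in\mathbb{R}^N:\|\mathbf{x}\|_0\le S\}$, $\sigma>0$, observation $\mathbf{y}=\mathbf{x}+\mathbf{n}\in\mathbb{R}^N$ with $\mathbf{n}\sim\mathcal{N}(\mathbf{0},\sigma^2\mathbf{I})$, $\mathbf{x}\in\mathcal{X}_S$, parameter function $g:\mathcal{X}_S\to\mathbb{R}$, and $\mathbf{x}_0\in\mathcal{X}_S$. Define $\nu_{\mathbf{x}_0}(\mathbf{x})=\exp\big(-\tfrac{1}{2\sigma^2}\|\mathbf{x}_0\|_2^2+\tfrac{1}{\sigma^2}\mathbf{x}^T\mathbf{x}_0\big)$ and $\psi_{\mathbf{x}_0}(\mathbf{x},\mathbf{y})=\exp\big(\tfrac{\mathbf{y}^T(\sigma\mathbf{x}-\mathbf{x}_0)}{\sigma^2}+\tfrac{\mathbf{x}_0^T\mathbf{x}}{\sigma}-\tfrac{\|\mathbf{x}\|_2^2}{2}\big)$. (1) A bias function $c:\mathcal{X}_S\to\mathbb{R}$ is valid at $\mathbf{x}_0$ if and only if $\gamma=c+g$ can be written as $\gamma(\mathbf{x})=\frac{1}{\nu_{\mathbf{x}_0}(\mathbf{x})}\sum_{\mathbf{p}\in\mathbb{Z}_+^N\cap\mathcal{X}_S}\frac{a[\mathbf{p}]}{\sqrt{\mathbf{p}!}}\big(\tfrac{\mathbf{x}}{\sigma}\big)^{\mathbf{p}}$ for all $\mathbf{x}\in\mathcal{X}_S$, with some $a\in\ell^2(\mathbb{Z}_+^N\cap\mathcal{X}_S)$;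 this sequence is unique for given $c$. (2) If $c$ is valid at $\mathbf{x}_0$, let $a_{\mathbf{x}_0}[\mathbf{p}]=\frac{1}{\sqrt{\mathbf{p}!}}\frac{\partial^{\mathbf{p}}(\gamma(\sigma\mathbf{x})\nu_{\mathbf{x}_0}(\sigma\mathbf{x}))}{\partial\mathbf{x}^{\mathbf{p}}}\big|_{\mathbf{x}=\mathbf{0}}$ for $\mathbf{p}\in\mathbb{Z}_+^N\cap\mathcal{X}_S$. Then (a) the minimum achievable variance at $\mathbf{x}_0$ is $M(c,\mathbf{x}_0)=\sum_{\mathbf{p}\in\mathbb{Z}_+^N\cap\mathcal{X}_S}a_{\mathbf{x}_0}^2[\mathbf{p}]-\gamma^2(\mathbf{x}_0)$; and (b) the LMV estimator at $\mathbf{x}_0$ is $$\hat g^{(c,\mathbf{x}_0)}(\mathbf{y})=\sum_{\mathbf{p}\in\mathbb{Z}_+^N\cap\mathcal{X}_S}\frac{a_{\mathbf{x}_0}[\mathbf{p}]}{\sqrt{\mathbf{p}!}}\frac{\partial^{\mathbf{p}}\psi_{\mathbf{x}_0}(\mathbf{x},\mathbf{y})}{\partial\mathbf{x}^{\mathbf{p}}}\Big|_{\mathbf{x}=\mathbf{0}}.$$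
   Context: $\mathbb{Z}_+^N\cap\mathcal{X}_S$ is the set of multi-indices $\mathbf{p}\in\mathbb{Z}_+^N$ with at most $S$ nonzero entries; $\mathbf{p}!=\prod p_l!$, $\mathbf{z}^{\mathbf{p}}=\prod z_l^{p_l}$, $\partial^{\mathbf{p}}/\partial\mathbf{x}^{\mathbf{p}}=\prod\partial^{p_l}/\partial x_l^{p_l}$. An estimator $\hat g:\mathbb{R}^N\to\mathbb{R}$ has bias $\mathsf{E}_{\mathbf{x}}\{\hat g(\mathbf{y})\}-g(\mathbf{x})$ and variance $v(\hat g;\mathbf{x})$. $c$ is valid at $\mathbf{x}_0$ if some estimator has finite variance at $\mathbf{x}_0$ and bias equal to $c$ on all of $\mathcal{X}_S$; $M(c,\mathbf{x}_0)$ is the infimum of $v(\hat g;\mathbf{x}_0)$ over such estimators; an LMV estimator is one attaining it. *)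

(* Defs.v *)
From HB Require Import structures.
From mathcomp Require Import all_boot all_order all_algebra.
From mathcomp Require Import all_classical all_reals all_analysis.
Import Order.TTheory GRing.Theory Num.Theory.
Import numFieldNormedType.Exports.


Local Open Scope classical_set_scope.
Local Open Scope ring_scope.

Definition XS {R : realType} (N S : nat) : set 'rV[R]_N :=
  [set x : 'rV[R]_N | (#|[set l : 'I_N | x ord0 l != 0%R]| <= S)%N].

Definition dotv {R : realType} {N : nat} (x y : 'rV[R]_N) : R :=
  \sum_(l < N) x ord0 l * y ord0 l.

Definition nu {R : realType} {N : nat} (s : R) (x0 x : 'rV[R]_N) : R :=
  expR (- dotv x0 x0 / (2 * s ^+ 2) + dotv x x0 / s ^+ 2).

Definition psi {R : realType} {N : nat} (s : R) (x0 x y : 'rV[R]_N) : R :=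
  expR (dotv y (s *: x - x0) / s ^+ 2 + dotv x0 x / s - dotv x x / 2).

Definition MI (N S : nat) : set {ffun 'I_N -> nat} :=
  [set p | (#|[set l : 'I_N | p l != 0%N]| <= S)%N].

Definition mfact {N : nat} (p : {ffun 'I_N -> nat}) : nat := (\prod_(l < N) (p l)`!)%N.

Definition mpow {R : realType} {N : nat} (z : 'rV[R]_N) (p : {ffun 'I_N -> nat}) : R :=
  \prod_(l < N) z ord0 l ^+ p l.

Definition pder {R : realType} {N : nat} (l : 'I_N) (f : 'rV[R]_N -> R) : 'rV[R]_N -> R :=
  'D_(delta_mx ord0 l) f.

Definition mder {R : realType} {N : nat} (p : {ffun 'I_N -> nat}) (f : 'rV[R]_N -> R)
  : 'rV[R]_N -> R :=
  foldr (fun l h => iter (p l) (pder l) h) f (enum 'I_N).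

(* sum over a countable index set of a real family, as an (unordered)
   extended-real sum: positive part minus negative part *)
Definition ssum {R : realType} {T : choiceType} (D : set T) (F : T -> R) : \bar R :=
  (\esum_(i in D) (Num.max (F i) 0)%:E - \esum_(i in D) (Num.max (- F i) 0)%:E)%E.

Definition l2 {R : realType} {T : choiceType} (D : set T) (a : T -> R) : Prop :=
  (\esum_(i in D) ((a i) ^+ 2)%:E < +oo)%E.

(* iterated integral against the product of the 1-d normal laws
   N(m_1,s^2) x ... x N(m_n,s^2), for nonnegative integrands *)
Fixpoint gint {R : realType} (s : R) {n : nat} :
    n.-tuple R -> (n.-tuple R -> \bar R) -> \bar R :=
  match n return n.-tuple R -> (n.-tuple R -> \bar R) -> \bar R with
  | 0%N => fun _ f => f [tuple]
  | k.+1 => fun m f =>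
      (\int[normal_prob (thead m) s]_t
         gint s (n:=k) (behead_tuple m) (fun y => f (cons_tuple t y)))%E
  end.

Definition tup {R : realType} {N : nat} (x : 'rV[R]_N) : N.-tuple R :=
  [tuple x ord0 i | i < N].

Definition rowt {R : realType} {N : nat} (y : N.-tuple R) : 'rV[R]_N :=
  \row_(i < N) tnth y i.

Definition Ex {R : realType} {N : nat} (s : R) (x : 'rV[R]_N) (h : 'rV[R]_N -> R) : \bar R :=
  (gint s (tup x) (fun y => (Num.max (h (rowt y)) 0)%:E)
   - gint s (tup x) (fun y => (Num.max (- h (rowt y)) 0)%:E))%E.

Definition estimator {R : realType} {N : nat} (h : 'rV[R]_N -> R) : Prop :=
  measurable_fun [set: N.-tuple R] (fun y => h (rowt y)).

Definition var {R : realType} {N : nat} (s : R) (x : 'rV[R]_N) (h : 'rV[R]_N -> R) : \bar R :=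
  Ex s x (fun y => (h y - fine (Ex s x h)) ^+ 2).

Definition admissible {R : realType} {N : nat} (S : nat) (s : R) (g c : 'rV[R]_N -> R)
    (x0 : 'rV[R]_N) (h : 'rV[R]_N -> R) : Prop :=
  [/\ estimator h, (var s x0 h < +oo)%E &
      forall x, XS N S x -> (Ex s x h = (c x + g x)%:E)%E].

Definition valid {R : realType} {N : nat} (S : nat) (s : R) (g c : 'rV[R]_N -> R)
    (x0 : 'rV[R]_N) : Prop :=
  exists h, admissible S s g c x0 h.

Definition Mmin {R : realType} {N : nat} (S : nat) (s : R) (g c : 'rV[R]_N -> R)
    (x0 : 'rV[R]_N) : \bar R :=
  ereal_inf [set var s x0 h | h in admissible S s g c x0].

Definition LMV {R : realType} {N : nat} (S : nat) (s : R) (g c : 'rV[R]_N -> R)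
    (x0 : 'rV[R]_N) (h : 'rV[R]_N -> R) : Prop :=
  admissible S s g c x0 h /\ var s x0 h = Mmin S s g c x0.

Definition acoef {R : realType} {N : nat} (s : R) (gam : 'rV[R]_N -> R)
    (x0 : 'rV[R]_N) (p : {ffun 'I_N -> nat}) : R :=
  (Num.sqrt (mfact p)%:R)^-1 *
  mder p (fun x => gam (s *: x) * nu s x0 (s *: x)) 0.

Definition lmv_term {R : realType} {N : nat} (s : R) (gam : 'rV[R]_N -> R)
    (x0 : 'rV[R]_N) (p : {ffun 'I_N -> nat}) (y : 'rV[R]_N) : R :=
  acoef s gam x0 p / Num.sqrt (mfact p)%:R * mder p (fun x => psi s x0 x y) 0.

(* Main.v *)
(* The density of N(x, s^2 I) with respect to N(x0, s^2 I), multiplied by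
   nu x0 x, is psi x0 (x / s), so an estimator h with finite variance at x0 has
   mean gamma on X_S iff gamma(x) nu(x) = E_x0 [h psi(x / s)] there.  A product
   psi(x) psi(z) is, up to the factor exp(x.z), again a Gaussian density, whence
   E_x0 [psi(x) psi(z)] = exp(x.z).  Differentiating under the expectation at 0,
   first in z and then in x, gives E_x0 [psi(x) d^p psi(0)] = x^p and shows that
   the e_p = d^p psi(0) / sqrt(p!) are orthonormal in L^2(P_x0).  For x in X_S
   the monomials x^p with p of support larger than S vanish, so Parseval turns
   exp(x.x) = sum x^(2p) / p! into psi(x) = sum_(p in MI) x^p / sqrt(p!) e_p in
   L^2.  Representations of gamma thus correspond to prescribing the coefficients
   E_x0 [h e_p], p in MI, which are the derivatives a_x0[p]; Bessel bounds
   E_x0 [h^2] below by their square sum, and Riesz-Fischer provides an h that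
   attains the bound. *)

Require Import Defs.
From HB Require Import structures.
From mathcomp Require Import all_boot all_order all_algebra.
From mathcomp Require Import all_classical all_reals all_analysis.
From mathcomp Require Import measurable_realfun ring lra.
Import Order.TTheory GRing.Theory Num.Theory.
Import numFieldNormedType.Exports.
Local Open Scope classical_set_scope.
Local Open Scope ring_scope.
Set Implicit Arguments.
Unset Strict Implicit.
Unset Printing Implicit Defensive.

(** * Gaussian integrals over tuples *)

Section gaussian_integral.
Context {R : realType}.
Implicit Types (m s t : R).
Notation mu := (@lebesgue_measure R).

(** Holds because the Radon-Nikodym derivative of [normal_prob] and [normal_pdf] have the same
    integral over every measurable set, hence agree almost everywhere. *)
Lemma ge0_integral_normal_prob m s (f : measurableTypeR R -> \bar R) :
  measurable_fun [set: measurableTypeR R] f -> (forall t, 0 <= f t)%E ->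
  (\int[normal_prob m s]_t f t = \int[mu]_t (f t * (normal_pdf m s t)%:E))%E.
Proof.
move=> mf f0.
have dom := @normal_prob_dominates R m s.
rewrite -(Radon_Nikodym_SigmaFinite.change_of_variables dom)//.
have mpdf : measurable_fun [set: measurableTypeR R] (fun t => (normal_pdf m s t)%:E).
  by apply/measurable_EFinP; exact: measurable_normal_pdf.
have intf := Radon_Nikodym_SigmaFinite.f_integrable dom.
apply: ae_eq_integral => //.
- by apply: emeasurable_funM => //; exact: measurable_int intf.
- exact: emeasurable_funM.
- apply: ae_eqe_mul2l; apply: integral_ae_eq => // A _ mA.
  by rewrite -Radon_Nikodym_SigmaFinite.f_integral.
Qed.

(* The density of N(m', s^2) with respect to N(m, s^2). *)
Definition gauss_ratio s m m' t : R :=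
  expR ((t * (m' - m)) / s ^+ 2 - (m' ^+ 2 - m ^+ 2) / (2 * s ^+ 2)).

Lemma measurable_gauss_ratio s m m' :
  measurable_fun [set: measurableTypeR R] (gauss_ratio s m m').
Proof.
apply: measurableT_comp => //; apply: measurable_funB => //.
by apply: measurable_funM => //; exact: measurable_funM.
Qed.

Lemma gauss_ratio_ge0 s m m' t : 0 <= gauss_ratio s m m' t.
Proof. exact: expR_ge0. Qed.

Lemma normal_pdf_ratio s m m' t : s != 0 ->
  gauss_ratio s m m' t * normal_pdf m s t = normal_pdf m' s t.
Proof.
move=> s0; rewrite !normal_pdfE// mulrCA; congr (_ * _).
rewrite /normal_fun /gauss_ratio -expRD; congr expR.
by field.
Qed.

Lemma ge0_integral_normal_ratio s m m' (f : measurableTypeR R -> \bar R) : s != 0 ->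
  measurable_fun [set: measurableTypeR R] f -> (forall t, 0 <= f t)%E ->
  (\int[normal_prob m' s]_t f t =
   \int[normal_prob m s]_t (f t * (gauss_ratio s m m' t)%:E))%E.
Proof.
move=> s0 mf f0; rewrite (ge0_integral_normal_prob m' s)//.
rewrite (ge0_integral_normal_prob m s)//; last 2 first.
- apply: emeasurable_funM => //.
  by apply/measurable_EFinP; exact: measurable_gauss_ratio.
- by move=> t; rewrite mule_ge0// lee_fin gauss_ratio_ge0.
by apply: eq_integral => t _; rewrite -muleA -EFinM normal_pdf_ratio.
Qed.

(* [measurableTypeR R] and [R] carry the same sigma-algebra under different
   displays: integrals against [normal_prob] live on the former, the
   coordinates of a tuple on the latter. *)
Definition cons_pair n (ty : measurableTypeR R * n.-tuple R) : n.+1.-tuple R :=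
  cons_tuple (ty.1 : R) ty.2.

Lemma measurable_cons_pair n :
  measurable_fun [set: measurableTypeR R * n.-tuple R] (@cons_pair n).
Proof. by apply: measurable_cons => //; exact: measurable_fst. Qed.

Lemma measurable_cons_tuple n (t : R) :
  measurable_fun [set: n.-tuple R] (fun y => cons_tuple t y).
Proof. exact: measurable_cons. Qed.

(** Replaces the iterated integral by an integral against one probability measure, so that Fatou and
    L2 arguments apply. The measure starts as a Dirac mass at the empty tuple; each step pushes a
    product measure forward along [cons_pair]. *)
Lemma gint_probability (s : R) n (m : n.-tuple R) :
  exists P : probability (n.-tuple R) R,
  forall f : n.-tuple R -> \bar R, measurable_fun setT f ->
    (forall y, 0 <= f y)%E -> (gint s m f = \int[P]_y f y)%E.
Proof.
elim: n m => [|n IHn] m.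
  exists (dirac [tuple]) => f mf f0 /=.
  by rewrite integral_dirac// diracT mul1e.
have [P HP] := IHn (behead_tuple m).
pose X : {mfun (measurableTypeR R * n.-tuple R)%type >-> n.+1.-tuple R} :=
  HB.pack (@cons_pair n)
    (isMeasurableFun.Build _ _ _ _ _ (@measurable_cons_pair n)).
exists (distribution (normal_prob (thead m) s \x P)%E X) => f mf f0 /=.
rewrite ge0_integral_pushforward// fubini_tonelli1//; last 2 first.
- exact: (measurableT_comp mf (@measurable_cons_pair n)).
- by move=> *; exact: f0.
apply: eq_integral => t _; rewrite HP//.
exact: (measurableT_comp mf (@measurable_cons_tuple n t)).
Qed.

(** This is the measurability half of Tonelli's theorem, with the inner iterated integral seen as a
    true integral. *)
Lemma measurable_gint (s : R) n (m : n.-tuple R) (f : n.+1.-tuple R -> \bar R) :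
  measurable_fun setT f -> (forall y, 0 <= f y)%E ->
  measurable_fun [set: measurableTypeR R]
    (fun t => gint s m (fun y => f (cons_tuple t y))).
Proof.
move=> mf f0; have [P HP] := gint_probability s m.
rewrite [X in measurable_fun _ X](_ : _ =
    fun t : measurableTypeR R => (\int[P]_y (f \o @cons_pair n) (t, y))%E).
  2: apply/funext => t; rewrite HP//.
  2: exact: (measurableT_comp mf (@measurable_cons_tuple n t)).
apply: (@measurable_fun_fubini_tonelli_F _ _ _ _ _ P (f \o @cons_pair n)).
  2: by move=> ty; exact: f0.
exact: (measurableT_comp mf (@measurable_cons_pair n)).
Qed.

Lemma gint_ge0 (s : R) n (m : n.-tuple R) (f : n.-tuple R -> \bar R) :
  (forall y, 0 <= f y)%E -> (0 <= gint s m f)%E.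
Proof.
elim: n m f => [|n IHn] m f f0 //=.
by apply: integral_ge0 => t _; exact: IHn.
Qed.

Lemma eq_gint (s : R) n (m : n.-tuple R) (f g : n.-tuple R -> \bar R) :
  f =1 g -> gint s m f = gint s m g.
Proof. by move=> /funext ->. Qed.

(** The density of N(m', s^2 I) with respect to N(m, s^2 I). *)
Definition tuple_ratio s n (m m' y : n.-tuple R) : R :=
  \prod_(i < n) gauss_ratio s (tnth m i) (tnth m' i) (tnth y i).

Lemma tuple_ratio_ge0 s n (m m' y : n.-tuple R) : 0 <= tuple_ratio s m m' y.
Proof. by apply: prodr_ge0 => i _; exact: gauss_ratio_ge0. Qed.

Lemma measurable_tuple_ratio s n (m m' : n.-tuple R) :
  measurable_fun setT (tuple_ratio s m m').
Proof.
apply: measurable_prod => i _.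
exact: (measurableT_comp (@measurable_gauss_ratio _ _ _) (measurable_tnth i)).
Qed.

Lemma tuple_ratio_cons s n (m m' : n.+1.-tuple R) t (y : n.-tuple R) :
  tuple_ratio s m m' (cons_tuple t y) =
  gauss_ratio s (thead m) (thead m') t *
  tuple_ratio s (behead_tuple m) (behead_tuple m') y.
Proof.
rewrite /tuple_ratio big_ord_recl; congr (_ * _).
apply: eq_bigr => i _; rewrite !tnth_behead tnthS.
by have -> : lift ord0 i = inord i.+1 by apply/val_inj; rewrite /= inordK// ltnS.
Qed.

(** One coordinate at a time: the head is changed by the one-dimensional formula, the tail by
    induction. *)
Lemma gint_change_mean s n (m m' : n.-tuple R) (f : n.-tuple R -> \bar R) :
  s != 0 -> measurable_fun setT f -> (forall y, 0 <= f y)%E ->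
  gint s m' f = gint s m (fun y => (f y * (tuple_ratio s m m' y)%:E)%E).
Proof.
move=> s0; elim: n m m' f => [|n IHn] m m' f mf f0 /=.
  by rewrite /tuple_ratio big_ord0 mule1.
have mft t : measurable_fun setT (fun y : n.-tuple R => f (cons_tuple t y)).
  exact: (measurableT_comp mf (@measurable_cons_tuple n t)).
rewrite (@ge0_integral_normal_ratio s (thead m))//; last 2 first.
- exact: measurable_gint.
- by move=> t; exact: gint_ge0.
apply: eq_integral => t _.
rewrite (IHn (behead_tuple m))//.
have [P HP] := gint_probability s (behead_tuple m).
have mr : measurable_fun setT (fun y : n.-tuple R =>
    f (cons_tuple t y) *
      (tuple_ratio s (behead_tuple m) (behead_tuple m') y)%:E)%E.
  apply: emeasurable_funM => //.
  by apply/measurable_EFinP; exact: measurable_tuple_ratio.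
have r0 y : (0 <= f (cons_tuple t y) *
    (tuple_ratio s (behead_tuple m) (behead_tuple m') y)%:E)%E.
  by rewrite mule_ge0// lee_fin tuple_ratio_ge0.
(* The factor of the head is constant for the inner integral and moves inside it. *)
rewrite HP// muleC -ge0_integralZl//; last by rewrite lee_fin gauss_ratio_ge0.
under [in RHS]eq_gint => y do rewrite tuple_ratio_cons.
rewrite HP//; last 2 first.
- apply: emeasurable_funM => //; apply/measurable_EFinP.
  by apply: measurable_funM => //; exact: measurable_tuple_ratio.
- move=> y; rewrite mule_ge0// lee_fin mulr_ge0 ?gauss_ratio_ge0//.
  exact: tuple_ratio_ge0.
by apply: eq_integral => y _; rewrite EFinM muleCA.
Qed.

End gaussian_integral.

(** * Square-integrable functions *)

Section square_integrable.
Context d (T : measurableType d) (R : realType) (P : probability T R).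
Implicit Types f g h : T -> R.

Definition sqint f :=
  measurable_fun setT f /\ P.-integrable setT (fun y => (f y ^+ 2)%:E).

(** [Rintegral] is total, with a default value for infinite integrals; linearity is therefore stated
    under [sqint] only. *)
Definition ip f g : R := Rintegral P setT (fun y => f y * g y).

Lemma integrable_sqintM f g : sqint f -> sqint g ->
  P.-integrable setT (fun y => (f y * g y)%:E).
Proof.
move=> [mf if2] [mg ig2].
apply: (le_integrable _ _ _ (integrableD _ if2 ig2)) => //.
  by apply/measurable_EFinP; exact: measurable_funM.
move=> y _ /=; rewrite lee_fin normrM.
rewrite [leRHS]ger0_norm ?addr_ge0 ?sqr_ge0//.
rewrite -(real_normK (num_real (f y))) -(real_normK (num_real (g y))).
have := normr_ge0 (f y); have := normr_ge0 (g y); nra.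
Qed.

Lemma sqintD f g : sqint f -> sqint g -> sqint (f \+ g).
Proof.
move=> sf sg; have [mf if2] := sf; have [mg ig2] := sg; split.
  exact: measurable_funD.
have := integrableD measurableT (integrableD measurableT if2 ig2)
  (integrableZl measurableT 2 (integrable_sqintM sf sg)).
apply: eq_integrable => // y _ /=; rewrite -EFinM -!EFinD; congr EFin.
by ring.
Qed.

Lemma sqintZ (k : R) f : sqint f -> sqint (fun y => k * f y).
Proof.
move=> [mf if2]; split; first exact: measurable_funM.
have := integrableZl measurableT (k ^+ 2) if2.
by apply: eq_integrable => // y _ /=; rewrite -EFinM exprMn.
Qed.

Lemma sqint_cst (k : R) : sqint (cst k).
Proof.
by split => //; exact: (@finite_measure_integrable_cst _ _ _ P setT (k ^+ 2) measurableT).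
Qed.

Lemma sqintB f g : sqint f -> sqint g -> sqint (f \- g).
Proof.
move=> sf sg; rewrite (_ : f \- g = f \+ (fun y => (-1) * g y)).
  by apply: sqintD => //; exact: sqintZ.
by apply/funext => y /=; rewrite mulN1r.
Qed.

Lemma sqint_sum (I : Type) (X : seq I) (F : I -> T -> R) :
  (forall i, sqint (F i)) -> sqint (fun y => \sum_(i <- X) F i y).
Proof.
move=> sF; elim: X => [|i X IH].
  under eq_fun do rewrite big_nil; exact: (sqint_cst 0).
rewrite (_ : (fun y => _) = F i \+ (fun y => \sum_(i <- X) F i y)).
  exact: sqintD.
by apply/funext => y; rewrite big_cons.
Qed.

Lemma le_sqint f g : measurable_fun setT f -> (forall y, `|f y| <= g y) ->
  sqint g -> sqint f.
Proof.
move=> mf fg [mg ig]; split => //; apply: (le_integrable _ _ _ ig) => //.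
  by apply/measurable_EFinP; exact: measurable_funX.
move=> y _ /=; rewrite lee_fin !ger0_norm ?sqr_ge0//.
rewrite -(real_normK (num_real (f y))) ler_sqr ?nnegrE//.
exact: le_trans (normr_ge0 _) (fg y).
Qed.

Lemma ipC f g : ip f g = ip g f.
Proof. by apply: eq_Rintegral => y _; rewrite mulrC. Qed.

Lemma ipDl f g h : sqint f -> sqint g -> sqint h ->
  ip (f \+ g) h = ip f h + ip g h.
Proof.
move=> sf sg sh; rewrite /ip -RintegralD//; try exact: integrable_sqintM.
by apply: eq_Rintegral => y _ /=; rewrite mulrDl.
Qed.

Lemma ipBl f g h : sqint f -> sqint g -> sqint h ->
  ip (f \- g) h = ip f h - ip g h.
Proof.
move=> sf sg sh; rewrite /ip -RintegralB//; try exact: integrable_sqintM.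
by apply: eq_Rintegral => y _ /=; rewrite mulrBl.
Qed.

Lemma ipZl (k : R) f h : sqint f -> sqint h ->
  ip (fun y => k * f y) h = k * ip f h.
Proof.
move=> sf sh; rewrite /ip -RintegralZl//; last exact: integrable_sqintM.
by apply: eq_Rintegral => y _ /=; rewrite mulrA.
Qed.

Lemma ip_suml (I : Type) (X : seq I) (F : I -> T -> R) h :
  (forall i, sqint (F i)) -> sqint h ->
  ip (fun y => \sum_(i <- X) F i y) h = \sum_(i <- X) ip (F i) h.
Proof.
move=> sF sh; elim: X => [|i X IH].
  rewrite big_nil /ip; under eq_Rintegral do rewrite big_nil mul0r.
  by rewrite /Rintegral integral0.
rewrite big_cons -IH -ipDl//; last exact: sqint_sum.
by congr ip; apply/funext => y; rewrite big_cons.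
Qed.

Lemma ip_ge0 f : 0 <= ip f f.
Proof. by apply: Rintegral_ge0 => y _; rewrite -expr2 sqr_ge0. Qed.

Lemma EFin_ip f g : sqint f -> sqint g ->
  (ip f g)%:E = (\int[P]_y (f y * g y)%:E)%E.
Proof.
move=> sf sg; rewrite /ip /Rintegral fineK//.
by apply: integrable_fin_num => //; exact: integrable_sqintM.
Qed.

Lemma ipBB f g : sqint f -> sqint g ->
  ip (f \- g) (f \- g) = ip f f - 2 * ip f g + ip g g.
Proof.
move=> sf sg; rewrite ipBl ?[ip f (_ \- _)]ipC ?[ip g (_ \- _)]ipC ?ipBl//;
  try exact: sqintB.
by rewrite (ipC g f); ring.
Qed.

(** The polynomial t -> |f - t g|^2 is nonnegative. *)
Lemma ip_CauchySchwarz f g : sqint f -> sqint g ->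
  (ip f g) ^+ 2 <= ip f f * ip g g.
Proof.
move=> sf sg.
have quad (t : R) : 0 <= ip f f - 2 * t * ip f g + t ^+ 2 * ip g g.
  have := ip_ge0 (f \- (fun y => t * g y)).
  rewrite ipBB//; last exact: sqintZ.
  rewrite (ipC f) !ipZl//; last exact: sqintZ.
  rewrite (ipC g (fun y => t * g y)) ipZl// (ipC g f); congr (_ <= _); ring.
have [g0|g0] := eqVneq (ip g g) 0.
  rewrite g0 mulr0.
  (* If g has norm zero the polynomial is affine in t; at this t it equals [- ip f f - 2], which is
     negative. *)
  have := quad ((ip f f + 1) / ip f g); rewrite g0 mulr0 addr0.
  have [->|fg0] := eqVneq (ip f g) 0; first by rewrite expr0n.
  by rewrite -!mulrA mulVf// mulr1; have := ip_ge0 f; lra.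
have {}g0 : 0 < ip g g by rewrite lt_def g0 ip_ge0.
(* The minimiser of the quadratic. *)
have := quad (ip f g / ip g g).
rewrite -(ler_pM2r g0) mul0r.
suff -> : (ip f f - 2 * (ip f g / ip g g) * ip f g +
  (ip f g / ip g g) ^+ 2 * ip g g) * ip g g = ip f f * ip g g - ip f g ^+ 2.
  by rewrite subr_ge0.
by field; rewrite gt_eqF.
Qed.

Section orthonormal.
Variables (I : choiceType) (e : I -> T -> R).
Hypothesis se : forall i, sqint (e i).
Hypothesis oe : forall i j, ip (e i) (e j) = (i == j)%:R.

Definition osum (X : seq I) (a : I -> R) y := \sum_(i <- X) a i * e i y.

Lemma sqint_osum X a : sqint (osum X a).
Proof. by apply: sqint_sum => i; exact: sqintZ. Qed.

Lemma ip_osuml X a h : sqint h -> ip (osum X a) h = \sum_(i <- X) a i * ip (e i) h.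
Proof.
move=> sh; rewrite ip_suml//; last by move=> i; exact: sqintZ.
by apply: eq_bigr => i _; rewrite ipZl.
Qed.

Lemma ip_osum_basis X a i : uniq X ->
  ip (osum X a) (e i) = (i \in X)%:R * a i.
Proof.
move=> uX; rewrite ip_osuml//; under eq_bigr do rewrite oe.
have [iX|iX] := boolP (i \in X).
  rewrite (bigD1_seq i)//= eqxx mulr1 mul1r big1 ?addr0// => j /negbTE ->.
  by rewrite mulr0.
rewrite mul0r big_seq big1// => j jX.
by case: eqVneq => [ji|]; rewrite ?mulr0//; move: iX; rewrite -ji jX.
Qed.

Lemma ip_osum_norm X a : uniq X ->
  ip (osum X a) (osum X a) = \sum_(i <- X) a i ^+ 2.
Proof.
move=> uX; rewrite ip_osuml; last exact: sqint_osum.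
apply: eq_big_seq => i iX.
by rewrite ipC ip_osum_basis// iX mul1r expr2.
Qed.

(** Pythagoras for the orthogonal projection of h onto the span of the [e i] with i in X. *)
Lemma ip_osum_dist X h : sqint h -> uniq X ->
  let a i := ip h (e i) in
  ip (h \- osum X a) (h \- osum X a) = ip h h - \sum_(i <- X) a i ^+ 2.
Proof.
move=> sh uX a; rewrite ipBB//; last exact: sqint_osum.
rewrite ip_osum_norm// ipC ip_osuml//.
under [X in 2 * X]eq_bigr do rewrite ipC -/(a _) -expr2.
ring.
Qed.

End orthonormal.
End square_integrable.

(** * Completeness and Riesz-Fischer *)

Section finite_sums.
Context (R : realType) (I : choiceType).
Implicit Types (D : set I) (a : I -> R) (X : seq I).

Lemma ler_esum D a X : uniq X -> (forall i, i \in X -> D i) ->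
  ((\sum_(i <- X) a i)%:E <= \esum_(i in D) (a i)%:E)%E.
Proof.
move=> uX XD; apply: esum_ge; exists [set` X].
  by split; [exact: finite_seq|move=> i /=; exact: XD].
by rewrite -fsbig_seq// sumEFin.
Qed.

(** Passes from the supremum over finite sets to a duplicate-free list, the form in which the finite
    sums are manipulated. *)
Lemma esum_adherent D a (e : R) : 0 < e ->
  (\esum_(i in D) (a i)%:E \is a fin_num)%E ->
  exists X, [/\ uniq X, (forall i, i \in X -> D i) &
    (\esum_(i in D) (a i)%:E - e%:E < (\sum_(i <- X) a i)%:E)%E].
Proof.
move=> e0 fin; have [x [A [finA AD] <-] lt] := ub_ereal_sup_adherent e0 fin.
exists (finmap.enum_fset (fset_set A)); split.
- exact: finmap.fset_uniq.
- by move=> i; rewrite in_fset_set// inE => /AD.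
- by rewrite -sumEFin -fsbig_finite.
Qed.

End finite_sums.

Section completeness.
Context d (T : measurableType d) (R : realType) (P : probability T R).

(* The factor [4 ^+ k] turns the summability of the squared L2-increments into
   geometric decay of the increments at almost every point; the L2 bound then
   passes to the limit by Fatou. *)
Lemma sqint_complete (u : nat -> T -> R) :
  (forall k, sqint P (u k)) ->
  (forall k l, (k <= l)%N ->
    ip P (u l \- u k) (u l \- u k) <= 8^-1 ^+ k) ->
  exists h, sqint P h /\ forall k, ip P (h \- u k) (h \- u k) <= 8^-1 ^+ k.
Proof.
move=> su Cu.
pose B k := u k.+1 \- u k.
have sB k : sqint P (B k) by exact: sqintB.
pose w k y : \bar R := (4 ^+ k * B k y ^+ 2)%:E.
have mw k : measurable_fun setT (w k).
  apply/measurable_EFinP; apply: measurable_funM => //.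
  by apply: measurable_funX; exact: (sB k).1.
have w0 k y : (0 <= w k y)%E by rewrite lee_fin mulr_ge0 ?sqr_ge0 ?exprn_ge0.
pose W y := (\sum_(k <oo) w k y)%E.
have mW : measurable_fun setT W.
  by apply: (@ge0_emeasurable_sum _ _ _ _ w xpredT) => // k y _ _; exact: w0.
have W0 y : (0 <= W y)%E by apply: nneseries_ge0 => k _ _; exact: w0.
have intW : (\int[P]_y W y < +oo)%E.
  rewrite integral_nneseries//.
  apply: (@le_lt_trans _ _ (2%:E)%E); last exact: ltry.
  (* The k-th integral is at most 4^k 8^-k = 2^-k, which is 2 / 2^(k+1), so total mass 2
     suffices. *)
  apply: le_trans (epsilon_trick0 xpredT (_ : (0 <= 2 :> R)%R)); last by [].
  apply: lee_nneseries => [k _ _|k _]; first exact: integral_ge0.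
  under eq_integral do rewrite /w EFinM.
  rewrite ge0_integralZl//; last 2 first.
  - by apply/measurable_EFinP; apply: measurable_funX; exact: (sB k).1.
  - by move=> y _; rewrite lee_fin sqr_ge0.
  under eq_integral do rewrite expr2.
  rewrite -EFin_ip// -EFinM lee_fin.
  apply: (@le_trans _ _ (4 ^+ k * 8^-1 ^+ k)).
    by rewrite ler_wpM2l ?exprn_ge0// Cu.
  rewrite natrX exprS invfM mulrA divff// mul1r -exprVn -exprMn.
  by rewrite (_ : 4 / 8 = 2^-1 :> R)//; field.
pose Good := [set y | (W y < +oo)%E].
have mGood : measurable Good.
  rewrite -[Good]setTI; exact: emeasurable_fun_infty_o.
have aeG : {ae P, forall y, Good y}.
  have iW : P.-integrable setT W.
    apply/integrableP; split => //.
    by under eq_integral do rewrite gee0_abs//.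
  have := integrable_ae measurableT iW.
  apply: filterS => y /(_ I); rewrite ge0_fin_numE//.
have cu y : Good y -> cvgn (fun k => u k y).
  move=> Gy; have finW : W y \is a fin_num by rewrite ge0_fin_numE.
  (* Each term of the series W is at most its sum, so 4^k B_k^2 <= W, and a square root gives decay
     like 2^-k. *)
  have Bb k : `|B k y| <= geometric (Num.sqrt (fine (W y))) 2^-1 k.
    have le : 4 ^+ k * B k y ^+ 2 <= fine (W y).
      rewrite -lee_fin fineK//.
      apply: le_trans (nneseries_lim_ge k.+1 (fun n _ _ => w0 n y)).
      by rewrite big_nat_recr//= leeDr// sume_ge0.
    rewrite /geometric /= exprVn ler_pdivlMr ?exprn_gt0//.
    rewrite -ler_sqr ?nnegrE ?sqrtr_ge0 ?mulr_ge0 ?exprn_ge0//.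
    rewrite sqr_sqrtr ?fine_ge0// exprMn real_normK ?num_real// exprAC.
    by rewrite mulrC (_ : 2 ^+ 2 = 4 :> R)// -natrX.
  have ->: (fun k => u k y) = (fun k => u 0%N y + series (telescope (u^~ y)) k).
    by apply/funext => k; rewrite -(eq_sum_telescope (u^~ y)).
  apply: is_cvgD; first exact: is_cvg_cst.
  apply: normed_cvg.
  apply: (@series_le_cvg _ (fun k => `|B k y|)
    (geometric (Num.sqrt (fine (W y))) 2^-1)) => //.
    by move=> n; rewrite /geometric/= mulr_ge0 ?sqrtr_ge0 ?exprn_ge0.
  apply: is_cvg_geometric_series.
  by rewrite gtr0_norm ?invr_gt0// invf_lt1// ltr1n.
(* Cutting off outside [Good] makes the sequence converge at every point, so that its limit is
   measurable. *)
pose hk k y := u k y * \1_Good y.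
pose h y := limn (fun k => hk k y).
have ch y : hk^~ y @ \oo --> h y.
  suff : cvgn (hk^~ y) by [].
  have [yG|yG] := pselect (Good y).
    by apply: is_cvgM; [exact: cu|exact: is_cvg_cst].
  rewrite (_ : hk^~ y = fun=> 0); first exact: is_cvg_cst.
  by apply/funext => k; rewrite /hk indicE memNset// mulr0.
have mhk k : measurable_fun setT (hk k).
  by apply: measurable_funM; [exact: (su k).1|exact: measurable_indic].
have mh : measurable_fun setT h.
  by apply: (@measurable_fun_cvg _ _ _ _ hk) => // y _; exact: ch.
have bound k : (\int[P]_y ((h y - u k y) ^+ 2)%:E <= (8^-1 ^+ k)%:E)%E.
  have msq (f g : T -> R) : measurable_fun setT f -> measurable_fun setT g ->
      measurable_fun setT (fun y => ((f y - g y) ^+ 2)%:E).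
    by move=> mf mg; apply/measurable_EFinP/measurable_funX/measurable_funB.
  rewrite (@ge0_ae_eq_integral _ _ _ P setT _
    (fun y => ((h y - hk k y) ^+ 2)%:E))//; last 5 first.
  - by apply: msq => //; exact: (su k).1.
  - exact: msq.
  - by move=> y _; rewrite lee_fin sqr_ge0.
  - by move=> y _; rewrite lee_fin sqr_ge0.
  - apply: filterS aeG => y Gy _; congr (((_ - _) ^+ 2)%:E).
    by rewrite /hk indicE mem_set// mulr1.
  have -> : (\int[P]_y ((h y - hk k y) ^+ 2)%:E =
      \int[P]_y limn_einf (fun l => ((hk l y - hk k y) ^+ 2)%:E))%E.
    apply: eq_integral => y _.
    have cy : (fun l => ((hk l y - hk k y) ^+ 2)%:E) @ \oo -->
        ((h y - hk k y) ^+ 2)%:E.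
      apply: cvg_EFin; first exact: nearW.
      have cb : (fun l => hk l y - hk k y) @ \oo --> h y - hk k y.
        by apply: cvgB; [exact: ch|exact: cvg_cst].
      exact: (cvgM cb cb).
    by rewrite is_cvg_limn_einfE; [apply/esym/cvg_lim|apply/cvg_ex; eexists; exact: cy].
  apply: le_trans (fatou _ _ _ _) _ => //.
  - by move=> l; exact: msq.
  - by move=> l y _; rewrite lee_fin sqr_ge0.
  rewrite limn_einf_lim; apply: lime_le; first exact: is_cvg_einfs.
  apply: nearW => n; apply: ereal_inf_le.
  (* The index [maxn n k] lies in the tail from n and is also at least k, where the Cauchy bound
     [Cu] applies. *)
  exists (\int[P]_y ((hk (maxn n k) y - hk k y) ^+ 2)%:E)%E.
    by exists (maxn n k) => //=; exact: leq_maxl.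
  apply: (@le_trans _ _ (ip P (u (maxn n k) \- u k) (u (maxn n k) \- u k))%:E);
    last by rewrite lee_fin Cu// leq_maxr.
  rewrite EFin_ip; [|exact: sqintB..].
  apply: ge0_le_integral => //.
  - by move=> y _; rewrite lee_fin sqr_ge0.
  - exact: msq.
  - apply/measurable_EFinP/measurable_funM; apply: measurable_funB;
    by [exact: (su _).1].
  - move=> y _; rewrite lee_fin /hk -mulrBl exprMn -expr2 ler_piMr ?sqr_ge0//.
have sd k : sqint P (h \- u k).
  have m1 : measurable_fun setT (h \- u k).
    by apply: measurable_funB => //; exact: (su k).1.
  split => //; apply/integrableP; split.
    by apply/measurable_EFinP; exact: measurable_funX.
  under eq_integral do rewrite gee0_abs ?lee_fin ?sqr_ge0//.
  by apply: le_lt_trans (bound k) _; exact: ltry.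
exists h; split.
  rewrite (_ : h = (h \- u 0%N) \+ u 0%N); first exact: sqintD.
  by apply/funext => y /=; rewrite subrK.
by move=> k; rewrite -lee_fin EFin_ip//; exact: bound.
Qed.

End completeness.

(** Turns estimates valid at every scale 8^-k into exact equalities. *)
Lemma le_geometric_le0 (R : realType) (r C : R) :
  (forall k, r <= C * 8^-1 ^+ k) -> r <= 0.
Proof.
move=> rC; have c0 : geometric C 8^-1 @ \oo --> (0 : R).
  by apply: cvg_geometric; rewrite gtr0_norm ?invr_gt0// invf_lt1// ltr1n.
by apply: (cvgr_to_ge c0); apply: nearW => k; exact: rC.
Qed.

Lemma ler_sum_uniq (R : realType) (I : eqType) (a : I -> R) (X Y : seq I) :
  (forall i, 0 <= a i) -> uniq X -> uniq Y -> {subset X <= Y} ->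
  \sum_(i <- X) a i <= \sum_(i <- Y) a i.
Proof.
move=> a0 uX uY XY.
have pe : perm_eq X [seq i <- Y | i \in X].
  apply: uniq_perm => //; first exact: filter_uniq.
  move=> i; rewrite mem_filter; case: (boolP (i \in X)) => //= iX.
  by rewrite XY.
rewrite (perm_big _ pe)/= big_filter [leRHS](bigID (mem X))/= lerDl.
exact: sumr_ge0.
Qed.

Section riesz_fischer.
Context d (T : measurableType d) (R : realType) (P : probability T R).
Variables (I : choiceType) (e : I -> T -> R).
Hypothesis se : forall i, sqint P (e i).
Hypothesis oe : forall i j, ip P (e i) (e j) = (i == j)%:R.

(** Every finite partial sum falls short of the squared norm by a squared distance. *)
Lemma bessel (D : set I) h : sqint P h ->
  (\esum_(i in D) (ip P h (e i) ^+ 2)%:E <= (ip P h h)%:E)%E.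
Proof.
move=> sh; apply: ge_ereal_sup => _ [F [finF FD] <-].
rewrite fsbig_finite// sumEFin lee_fin -subr_ge0.
by rewrite -(ip_osum_dist se oe)// ?finmap.fset_uniq// ip_ge0.
Qed.

(** Partial sums over nested finite sets that miss less than 8^-k of the total form a sequence to
    which [sqint_complete] applies. No enumeration of D is required. *)
Lemma riesz_fischer (D : set I) (a : I -> R) : l2 D a ->
  exists h, [/\ sqint P h, (forall i, D i -> ip P h (e i) = a i) &
    (\esum_(i in D) (a i ^+ 2)%:E = (ip P h h)%:E)%E].
Proof.
move=> l2a.
have fin : (\esum_(i in D) (a i ^+ 2)%:E)%E \is a fin_num.
  by rewrite ge0_fin_numE// esum_ge0// => i _; rewrite lee_fin sqr_ge0.
pose A := fine (\esum_(i in D) (a i ^+ 2)%:E)%E.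
have AE : (\esum_(i in D) (a i ^+ 2)%:E = A%:E)%E by rewrite fineK.
have g0 k : 0 < 8^-1 ^+ k :> R by rewrite exprn_gt0// invr_gt0.
have /choice[X XP] k : exists X, [/\ uniq X, (forall i, i \in X -> D i) &
    A - 8^-1 ^+ k < \sum_(i <- X) a i ^+ 2].
  have [X [uX XD]] := esum_adherent (g0 k) fin.
  by rewrite AE -EFinB lte_fin => lt; exists X.
(* Merging all lists up to k makes the supports nested, which the Cauchy estimate uses. *)
pose G k := undup (flatten [seq X j | j <- iota 0 k.+1]).
have uG k : uniq (G k) by exact: undup_uniq.
have memG k i : i \in G k -> D i.
  rewrite mem_undup => /flattenP[_ /mapP[j _ ->]].
  by have [_ + _] := XP j; exact.
have XG k : {subset X k <= G k}.
  move=> i iX; rewrite mem_undup; apply/flattenP; exists (X k) => //.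
  by apply: map_f; rewrite mem_iota /= add0n.
have GG k l : (k <= l)%N -> {subset G k <= G l}.
  move=> kl i; rewrite !mem_undup => /flattenP[_ /mapP[j jk ->] iX].
  apply/flattenP; exists (X j) => //; apply: map_f.
  by move: jk; rewrite !mem_iota !add0n /= !ltnS => /leq_trans; exact.
pose c k := \sum_(i <- G k) a i ^+ 2.
have cA k : c k <= A by rewrite -lee_fin -AE ler_esum//; exact: memG.
have Ac k : A - 8^-1 ^+ k < c k.
  have [uX _ /lt_le_trans] := XP k; apply.
  by apply: ler_sum_uniq => // i; exact: sqr_ge0.
pose u k := osum e (G k) a.
have su k : sqint P (u k) by exact: sqint_osum.
have Cu k l : (k <= l)%N -> ip P (u l \- u k) (u l \- u k) <= 8^-1 ^+ k.
  move=> kl; rewrite ipBB// !ip_osum_norm//.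
  rewrite [ip _ (u l) _]ipC ip_osuml//.
  have -> : \sum_(i <- G k) a i * ip P (e i) (u l) = c k.
    apply: eq_big_seq => i iG.
    by rewrite ipC ip_osum_basis// (GG _ _ kl _ iG) mul1r expr2.
  by rewrite -!/(c _); have := cA l; have := Ac k; lra.
have [h [sh hu]] := sqint_complete su Cu.
have ha i : D i -> ip P h (e i) = a i.
  move=> Di; apply/eqP; rewrite -subr_eq0 -sqrf_eq0 eq_le sqr_ge0 andbT.
  (* With z the coefficient of [u k], (x - a)^2 <= 2 (x - z)^2 + 2 (z - a)^2, and each square is at
     most 8^-k; hence the constant 4. *)
  apply: (@le_geometric_le0 _ _ 4) => k.
  have b1 : (ip P h (e i) - ip P (u k) (e i)) ^+ 2 <= 8^-1 ^+ k.
    rewrite -ipBl//; apply: le_trans (ip_CauchySchwarz _ _) _ => //.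
      exact: sqintB.
    by rewrite oe eqxx mulr1.
  have b2 : (ip P (u k) (e i) - a i) ^+ 2 <= 8^-1 ^+ k.
    rewrite ip_osum_basis//; case: (boolP (i \in G k)) => iG.
      by rewrite mul1r subrr expr0n/= ltW.
    rewrite mul0r sub0r sqrrN.
    (* An index outside [G k] can still be added without exceeding the total A, so its square is
       below the missing 8^-k. *)
    have : c k + a i ^+ 2 <= A.
      rewrite -lee_fin -AE addrC.
      rewrite -[X in X%:E](big_cons _ _ i (G k) xpredT (fun i => a i ^+ 2)).
      apply: ler_esum; first by rewrite /= iG uG.
      by move=> j; rewrite inE => /orP[/eqP->//|/memG].
    by have := Ac k; lra.
  move: b1 b2; set x := ip P h _; set z := ip P (u k) _; set g := _ ^+ k.
  have := sqr_ge0 (x - 2 * z + a i); nra.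
exists h; split => //; rewrite AE; congr EFin; apply/eqP.
rewrite -subr_eq0 -normr_eq0 eq_le normr_ge0 andbT.
(* Both A and the squared norm of h lie between [c k] and [c k] + 8^-k. *)
apply: (@le_geometric_le0 _ _ 1) => k; rewrite mul1r.
have : ip P (h \- u k) (h \- u k) = ip P h h - c k.
  rewrite /c -(eq_big_seq _ (fun i iG => congr1 (fun x => x ^+ 2) (ha i (memG k i iG)))).
  rewrite -(ip_osum_dist se oe)//; congr (ip _ (_ \- _) (_ \- _));
  by apply/funext => y; apply: eq_big_seq => i /memG /ha ->.
move=> E; have := hu k; have := ip_ge0 P (h \- u k); rewrite E.
by have := Ac k; have := cA k; rewrite ler_norml; lra.
Qed.

End riesz_fischer.

(** * Iterated partial derivatives and Hermite polynomials *)

Lemma is_derive_expR_comp (R : realType) (g : R -> R) (z b : R) :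
  is_derive z 1 g b -> is_derive z 1 (fun t => expR (g t)) (b * expR (g z)).
Proof.
by move=> dg; rewrite mulrC; exact: (is_derive1_comp (is_derive_expR (g z)) dg).
Qed.

Section partial_derivatives.
Context {R : realType} {N : nat}.
Implicit Types (f g : 'rV[R]_N -> R) (l : 'I_N) (x : 'rV[R]_N)
  (k p q : {ffun 'I_N -> nat}).

Definition set_coord l x (z : R) : 'rV[R]_N :=
  \row_i (if i == l then z else x ord0 i).

Lemma set_coordE l x z i :
  set_coord l x z ord0 i = if i == l then z else x ord0 i.
Proof. by rewrite mxE. Qed.

Lemma shift_coordE l x t :
  t *: delta_mx ord0 l + x = set_coord l x (t + x ord0 l).
Proof.
apply/rowP => i; rewrite !mxE eqxx /=; case: eqVneq => [->|_].
  by rewrite mulr1.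
by rewrite mulr0 add0r.
Qed.

Lemma set_coord_id l x : set_coord l x (x ord0 l) = x.
Proof. by apply/rowP => i; rewrite mxE; case: eqVneq => [->|]. Qed.

(** Reduces partial derivatives to one-variable calculus: both difference quotients are the same
    function. *)
Lemma pder_coord l f x (D : R) :
  is_derive (x ord0 l) 1 (fun z => f (set_coord l x z)) D -> pder l f x = D.
Proof.
move=> dg; rewrite -[RHS](@derive_val _ _ _ _ _ _ _ dg) /pder /derive.
rewrite (_ : (fun h : R => h^-1 *: ((f \o shift x) (h *: delta_mx ord0 l) - f x)) =
  (fun h => h^-1 *: (((fun z => f (set_coord l x z)) \o shift (x ord0 l)) (h *: 1)
     - f (set_coord l x (x ord0 l)))))//.
by apply/funext => t /=; rewrite shift_coordE scaler1 set_coord_id.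
Qed.

Definition incr_index k l : {ffun 'I_N -> nat} := [ffun i => (k i + (i == l))%N].

(** [F i j] stands for the j-th derivative of the i-th factor; only factor l depends on the moving
    coordinate. *)
Lemma is_derive_prod_coord l (F : 'I_N -> nat -> R -> R) (C : R) k x (z : R) :
  (forall i j (z : R), is_derive z 1 (F i j) (F i j.+1 z)) ->
  is_derive z 1 (fun z => C * \prod_(i < N) F i (k i) (set_coord l x z ord0 i))
    (C * \prod_(i < N) F i (incr_index k l i) (set_coord l x z ord0 i)).
Proof.
move=> dF.
pose c := C * \prod_(i < N | i != l) F i (k i) (x ord0 i).
rewrite (_ : (fun z => _) = (fun z => c * F l (k l) z)); last first.
  apply/funext => t; rewrite (bigD1 l)//= set_coordE eqxx.
  rewrite /c -mulrA; congr (_ * _); rewrite mulrC; congr (_ * _).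
  by apply: eq_bigr => i /negbTE il; rewrite set_coordE il.
rewrite (_ : C * _ = c * F l (k l).+1 z); first exact: is_deriveZ.
rewrite (bigD1 l)//= ffunE eqxx addn1 set_coordE eqxx.
rewrite /c -mulrA; congr (_ * _); rewrite mulrC; congr (_ * _).
by apply: eq_bigr => i /negbTE il; rewrite ffunE il addn0 set_coordE il.
Qed.

Lemma pder_prod l (F : 'I_N -> nat -> R -> R) (C : R) k x :
  (forall i j (z : R), is_derive z 1 (F i j) (F i j.+1 z)) ->
  pder l (fun x => C * \prod_(i < N) F i (k i) (x ord0 i)) x =
  C * \prod_(i < N) F i (incr_index k l i) (x ord0 i).
Proof.
move=> dF; apply: pder_coord.
by have := is_derive_prod_coord l C k x (x ord0 l) dF; rewrite set_coord_id.
Qed.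

Section mder_family.
Variable Phi : {ffun 'I_N -> nat} -> 'rV[R]_N -> R.
Hypothesis dPhi : forall k l x, pder l (Phi k) x = Phi (incr_index k l) x.

Lemma iter_pder_family k l n :
  iter n (pder l) (Phi k) = Phi [ffun i => (k i + n * (i == l))%N].
Proof.
elim: n => [|n IHn] /=.
  by congr Phi; apply/ffunP => i; rewrite ffunE mul0n addn0.
rewrite IHn; apply/funext => x; rewrite dPhi; congr (Phi _ _).
by apply/ffunP => i; rewrite !ffunE mulSnr addnA.
Qed.

(** Applies to any family closed under partial derivatives by index shift: products of one-variable
    functions, and later inner products with the kernel. *)
Lemma mder_family p : mder p (Phi [ffun=> 0%N]) = Phi p.
Proof.
(* For an arbitrary list the exponent is weighted by multiplicity; [enum] contains each coordinate
   exactly once. *)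
have H (r : seq 'I_N) :
    foldr (fun l h => iter (p l) (pder l) h) (Phi [ffun=> 0%N]) r =
    Phi [ffun i => (p i * count_mem i r)%N].
  elim: r => [|l r IHr] /=.
    by congr Phi; apply/ffunP => i; rewrite !ffunE muln0.
  rewrite IHr iter_pder_family; congr Phi; apply/ffunP => i; rewrite !ffunE.
  rewrite mulnDr addnC eq_sym; congr (_ + _)%N.
  by case: eqVneq => [->|]; rewrite ?muln0.
rewrite /mder H; congr Phi; apply/ffunP => i; rewrite !ffunE.
by rewrite count_uniq_mem ?enum_uniq// mem_enum muln1.
Qed.

End mder_family.

(** Only directions in the support of p are differentiated, so the values on that coordinate
    subspace decide. This is what makes derivatives of a function prescribed only on [XS]
    meaningful. *)
Lemma mder_local p f g :
  (forall x, (forall l, p l = 0%N -> x ord0 l = 0) -> f x = g x) ->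
  mder p f 0 = mder p g 0.
Proof.
move=> fg.
pose Z x := forall l, p l = 0%N -> x ord0 l = 0.
have pderZ l f1 g1 : p l != 0%N -> (forall x, Z x -> f1 x = g1 x) ->
    forall x, Z x -> pder l f1 x = pder l g1 x.
  move=> pl e x Zx; rewrite /pder /derive; rewrite (_ : (fun h : R =>
    h^-1 *: ((f1 \o shift x) (h *: delta_mx ord0 l) - f1 x)) =
    (fun h => h^-1 *: ((g1 \o shift x) (h *: delta_mx ord0 l) - g1 x)))//.
  apply/funext => t /=; rewrite !e// => l' pl'.
  rewrite shift_coordE set_coordE; case: eqVneq => [ll'|_]; last exact: Zx.
  by move: pl; rewrite -ll' pl'.
suff H (r : seq 'I_N) : forall x, Z x ->
    foldr (fun l h => iter (p l) (pder l) h) f r x =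
    foldr (fun l h => iter (p l) (pder l) h) g r x.
  by apply: H => l _; rewrite mxE.
elim: r => [|l r IHr] //=.
have [->//|pl] := eqVneq (p l) 0%N.
by elim: {1 2}(p l) => [//|n IHn] /=; exact: pderZ.
Qed.

(** In a coordinate where p and q differ, either a positive power is evaluated at 0 or the falling
    factorial vanishes. *)
Lemma mder_monomial p q : mder p (fun x : 'rV[R]_N => mpow x q) 0 =
  (p == q)%:R * (mfact p)%:R.
Proof.
pose F (i : 'I_N) j (z : R) := ((q i ^_ j)%:R *: 'X^(q i - j)).[z].
pose Phi k x := 1 * \prod_(i < N) F i (k i) (x ord0 i).
have dF i j (z : R) : is_derive z 1 (F i j) (F i j.+1 z).
  rewrite (_ : F i j.+1 z = ((q i ^_ j)%:R *: 'X^(q i - j))^`().[z]).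
    exact: is_derive_poly.
  rewrite /F derivZ derivXn ffactnSr natrM subnS -scalerA.
  by congr (_ *: _).[_]; rewrite scaler_nat.
have -> : (fun x : 'rV[R]_N => mpow x q) = Phi [ffun=> 0%N].
  apply/funext => x; rewrite /Phi mul1r; apply: eq_bigr => i _.
  by rewrite /F ffunE ffactn0 scale1r subn0 hornerXn.
rewrite (mder_family (Phi := Phi)); last by move=> k l x; exact: pder_prod.
rewrite /Phi mul1r; have [->|pq] := eqVneq p q.
  rewrite mul1r /mfact natr_prod; apply: eq_bigr => i _.
  by rewrite /F subnn expr0 hornerZ hornerC mulr1 ffactnn.
rewrite mul0r; have [i pqi] : exists i, p i != q i.
  by apply/existsP; apply: contraR pq => /existsPn H; apply/eqP/ffunP => i;
    apply/eqP; move: (H i); rewrite negbK.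
rewrite (bigD1 i)//= /F mxE hornerZ hornerXn; case: (ltngtP (p i) (q i)) => [lt|lt|eq].
- by rewrite expr0n subn_eq0 leqNgt lt mulr0 mul0r.
- by rewrite ffact_small// mul0r mul0r.
- by rewrite eq eqxx in pqi.
Qed.

Lemma mder_expR_dotv p (z : 'rV[R]_N) :
  mder p (fun x => expR (dotv x z)) 0 = mpow z p.
Proof.
pose F (i : 'I_N) j t := z ord0 i ^+ j * expR (t * z ord0 i).
pose Phi k (x : 'rV[R]_N) := 1 * \prod_(i < N) F i (k i) (x ord0 i).
have dF i j (t : R) : is_derive t 1 (F i j) (F i j.+1 t).
  have d1 : is_derive t 1 (fun t => t * z ord0 i) (z ord0 i).
    rewrite (_ : (fun t => _) = horner (z ord0 i *: 'X)); last first.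
      by apply/funext => u; rewrite hornerZ hornerX mulrC.
    rewrite -[X in is_derive _ _ _ X](_ : (z ord0 i *: 'X)^`().[t] = _).
      exact: is_derive_poly.
    by rewrite derivZ derivX hornerZ hornerC mulr1.
  rewrite (_ : F i j.+1 t = z ord0 i ^+ j * (z ord0 i * expR (t * z ord0 i))).
    exact: (is_deriveZ _ (is_derive_expR_comp d1)).
  by rewrite /F exprSr mulrA.
have -> : (fun x => expR (dotv x z)) = Phi [ffun=> 0%N].
  apply/funext => x; rewrite /Phi mul1r expR_sum; apply: eq_bigr => i _.
  by rewrite /F ffunE expr0 mul1r.
rewrite (mder_family (Phi := Phi)); last by move=> k l x; exact: pder_prod.
rewrite /Phi mul1r; apply: eq_bigr => i _.
by rewrite /F mxE mul0r expR0 mulr1.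
Qed.

End partial_derivatives.

(** * Hermite polynomials, their generating function and exponential bounds *)

Section hermite.
Context {R : realType}.

(** The probabilists' Hermite polynomials. *)
Fixpoint hermite n : {poly R} :=
  if n is n'.+1 then 'X * hermite n' - (hermite n')^`() else 1.

(** The n-th derivative in z of the generating function exp(w z - z^2 / 2). *)
Definition hermite_exp (w : R) n z : R :=
  (hermite n).[w - z] * expR (w * z - z ^+ 2 / 2).

Lemma is_derive_hermite_exp (w : R) n (z : R) :
  is_derive z 1 (hermite_exp w n) (hermite_exp w n.+1 z).
Proof.
pose A := hermite n \Po (w%:P - 'X); pose B := w *: 'X - 2^-1 *: 'X^2.
have BE t : B.[t] = w * t - t ^+ 2 / 2.
  by rewrite /B hornerD hornerN !hornerZ hornerX hornerXn (mulrC 2^-1).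
have AE t : A.[t] = (hermite n).[w - t].
  by rewrite /A horner_comp !hornerE.
rewrite (_ : hermite_exp w n = (fun t => A.[t] * expR B.[t])); last first.
  by apply/funext => t; rewrite AE BE.
have dA := is_derive_poly A z; have dB := is_derive_expR_comp (is_derive_poly B z).
rewrite (_ : hermite_exp w n.+1 z =
  A.[z] *: (B^`().[z] * expR B.[z]) + expR B.[z] *: A^`().[z]).
  exact: (is_deriveM dA dB).
rewrite BE AE /hermite_exp /= /GRing.scale /=.
have -> : A^`().[z] = - (hermite n)^`().[w - z].
  by rewrite /A deriv_comp derivB derivC derivX !hornerE horner_comp !hornerE; ring.
have -> : B^`().[z] = w - z.
  by rewrite /B derivB !derivZ derivX derivXn !hornerE; field.
by rewrite hornerD hornerN hornerM hornerX; ring.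
Qed.

(** Coefficientwise from |z|^i <= i! exp |z|. *)
Lemma horner_expR_bound (p : {poly R}) :
  exists2 K : R, 0 <= K & forall z, `|p.[z]| <= K * expR `|z|.
Proof.
exists (\sum_(i < size p) `|p`_i| * i`!%:R).
  by apply: sumr_ge0 => i _; rewrite mulr_ge0.
move=> z; rewrite horner_coef; apply: le_trans (ler_norm_sum _ _ _) _.
rewrite mulr_suml; apply: ler_sum => i _; rewrite normrM -mulrA.
rewrite ler_wpM2l// normrX -ler_pdivrMl ?ltr0n ?fact_gt0// mulrC.
case: (nat_of_ord i) => [|n].
  by rewrite expr0 fact0 divr1 -expR0 ler_expR.
by apply: le_trans (expR_ge1Dxn n (normr_ge0 z)); rewrite lerDr.
Qed.

End hermite.

(** A bound uniform in z, needed for dominated differentiation. The polynomial costs exp(|w| + r)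
    and the exponential exp(r |w|); the two-sided sum removes the absolute value of w. *)
Lemma hermite_exp_bound (R : realType) n (r : R) : 0 <= r ->
  exists2 K : R, 0 <= K & forall w z, `|z| <= r ->
    `|hermite_exp w n z| <= K * (expR ((r + 1) * w) + expR (- (r + 1) * w)).
Proof.
move=> r0; have [K K0 KP] := horner_expR_bound (hermite n : {poly R}).
exists (K * expR r); first by rewrite mulr_ge0// expR_ge0.
move=> w z zr; rewrite normrM [X in _ * X]ger0_norm ?expR_ge0//.
apply: (@le_trans _ _ (K * expR (`|w| + r) * expR (r * `|w|))).
  apply: ler_pM => //.
    apply: le_trans (KP _) _; rewrite ler_wpM2l// ler_expR.
    by apply: le_trans (ler_normB _ _) _; rewrite lerD2l.
  rewrite ler_expR; apply: (@le_trans _ _ (w * z)).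
    by rewrite gerBl divr_ge0 ?sqr_ge0.
  by apply: le_trans (ler_norm _) _; rewrite normrM mulrC ler_wpM2r.
rewrite -!mulrA; apply: ler_wpM2l => //.
rewrite -expRD (_ : `|w| + r + r * `|w| = r + (r + 1) * `|w|); last by ring.
rewrite expRD; apply: ler_wpM2l; first exact: expR_ge0.
have [w0|w0] := lerP 0 w.
  by rewrite ger0_norm// lerDl expR_ge0.
by rewrite ltr0_norm// mulrN -mulNr lerDr expR_ge0.
Qed.

(** * The kernel psi in L2 *)

Lemma measurable_horner_real (R : realType) (p : {poly R}) :
  measurable_fun [set: R] (horner p).
Proof. by apply: continuous_measurable_fun; exact: continuous_horner. Qed.

Section gaussian_kernel.
Context {R : realType} {N : nat}.
Variables (s : R) (x0 : 'rV[R]_N).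
Hypothesis s0 : 0 < s.
Implicit Types (x z : 'rV[R]_N) (k p : {ffun 'I_N -> nat}).

Let s_neq0 : s != 0. Proof. by rewrite gt_eqF. Qed.

(* [psi] is the Hermite generating function, up to a factor free of [x]. *)
Definition psi_der k x (y : 'rV[R]_N) : R :=
  expR (- dotv y x0 / s ^+ 2) *
  \prod_(l < N) hermite_exp ((y ord0 l + x0 ord0 l) / s) (k l) (x ord0 l).

Lemma psi_derE x y : psi s x0 x y = psi_der [ffun=> 0%N] x y.
Proof.
rewrite /psi_der /psi.
under eq_bigr do rewrite ffunE /hermite_exp /= hornerC mul1r.
rewrite -expR_sum -expRD; congr expR.
rewrite /dotv -sumrN !mulr_suml -sumrN -!big_split /=.
by apply: eq_bigr => l _; rewrite !mxE; field.
Qed.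

Lemma mder_psi p y : mder p (fun x => psi s x0 x y) 0 = psi_der p 0 y.
Proof.
rewrite (_ : (fun x => _) = psi_der [ffun=> 0%N] ^~ y); last first.
  by apply/funext => x; rewrite psi_derE.
rewrite (@mder_family _ _ (fun k x => psi_der k x y))// => k l x.
apply: (@pder_prod _ _ l
  (fun i => hermite_exp ((y ord0 i + x0 ord0 i) / s))) => i j t.
exact: is_derive_hermite_exp.
Qed.

Lemma psi_ratio x (y : N.-tuple R) :
  tuple_ratio s (tup x0) (tup x) y * nu s x0 x =
  psi s x0 (s^-1 *: x) (rowt y).
Proof.
rewrite /tuple_ratio /nu /psi -expR_sum -expRD; congr expR.
rewrite /dotv -sumrN !mulr_suml -sumrN -!big_split /=.
by apply: eq_bigr => l _; rewrite !tnth_mktuple !mxE; field.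
Qed.

(** Completing the square: the exponents add up to a Gaussian likelihood ratio with the displayed
    shifted mean. *)
Lemma psi_psi x z (y : N.-tuple R) :
  psi s x0 x (rowt y) * psi s x0 z (rowt y) =
  expR (dotv x z) * tuple_ratio s (tup x0) (tup (s *: (x + z) - x0)) y.
Proof.
rewrite /tuple_ratio /psi -expR_sum -!expRD; congr expR.
rewrite /dotv !mulr_suml -!sumrN -!big_split /=.
by apply: eq_bigr => l _; rewrite !tnth_mktuple !mxE; field.
Qed.

Lemma measurable_psi_der k x :
  measurable_fun setT (fun y : N.-tuple R => psi_der k x (rowt y)).
Proof.
have mt l : measurable_fun setT (fun y : N.-tuple R => rowt y ord0 l).
  rewrite (_ : (fun y => _) = fun y : N.-tuple R => tnth y l).
    exact: measurable_tnth.
  by apply/funext => y; rewrite mxE.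
apply: measurable_funM.
  apply: measurableT_comp => //; apply: measurable_funM => //.
  apply: measurableT_comp => //; apply: measurable_sum => l.
  exact: measurable_funM.
apply: measurable_prod => l _.
have mw : measurable_fun setT (fun y : N.-tuple R => (rowt y ord0 l + x0 ord0 l) / s).
  by apply: measurable_funM => //; exact: measurable_funD.
apply: measurable_funM.
  apply: (measurableT_comp (measurable_horner_real _)).
  exact: measurable_funB.
apply: measurableT_comp => //; apply: measurable_funB => //.
exact: measurable_funM.
Qed.

Definition corner (B : R) (e : {ffun 'I_N -> bool}) : 'rV[R]_N :=
  \row_l (if e l then B else - B).

(** A majorant built from the kernel itself, so that its square-integrability is inherited from
    [psi]. *)
Definition psi_dom (B : R) (y : 'rV[R]_N) : R :=
  \sum_(e : {ffun 'I_N -> bool}) psi s x0 (corner B e) y.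

(* Products of two-sided exponentials are sums of [psi] over the corners of a
   cube. *)
Lemma psi_der_bound k (r : R) : 0 <= r ->
  exists2 K : R, 0 <= K & forall x y, (forall l, `|x ord0 l| <= r) ->
    `|psi_der k x y| <= K * psi_dom (r + 1) y.
Proof.
move=> r0.
have /choice[K KP] (l : 'I_N) : exists K : R, 0 <= K /\ forall w z : R, `|z| <= r ->
    `|hermite_exp w (k l) z| <= K * (expR ((r + 1) * w) + expR (- (r + 1) * w)).
  by have [K K0 KP] := hermite_exp_bound (k l) r0; exists K.
have eB (b : bool) (w : R) : expR ((if b then r + 1 else - (r + 1)) * w) =
    expR ((r + 1) ^+ 2 / 2) * hermite_exp w 0 (if b then r + 1 else - (r + 1)).
  rewrite /hermite_exp /= hornerC mul1r -expRD; congr expR.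
  by case: b; field.
exists ((\prod_l K l) * \prod_(l < N) expR ((r + 1) ^+ 2 / 2)).
  by apply: mulr_ge0; apply: prodr_ge0 => l _; [exact: (KP l).1|exact: expR_ge0].
move=> x y xr; rewrite /psi_der normrM (ger0_norm (expR_ge0 _)) normr_prod.
set C := expR _.
apply: (@le_trans _ _ (C * \prod_(l < N) (K l *
    \sum_(b : bool) expR ((if b then r + 1 else - (r + 1)) *
       ((y ord0 l + x0 ord0 l) / s))))).
  apply: ler_wpM2l; first exact: expR_ge0.
  apply: ler_prod => l _; rewrite normr_ge0 /= big_bool/=.
  exact: (KP l).2.
(* Expanding the product of two-term sums yields one term per choice of signs, that is, per
   corner. *)
rewrite big_split/= bigA_distr_bigA/= mulrCA -mulrA; apply: ler_wpM2l.
  by apply: prodr_ge0 => l _; exact: (KP l).1.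
rewrite /psi_dom !mulr_sumr; apply: ler_sum => e _.
rewrite psi_derE /psi_der -/C mulrCA; apply: ler_wpM2l; first exact: expR_ge0.
rewrite -big_split/= le_eqVlt; apply/orP; left; apply/eqP.
by apply: eq_bigr => l _; rewrite eB ffunE mxE.
Qed.

Variable P : probability (N.-tuple R) R.
Hypothesis HP : forall f : N.-tuple R -> \bar R, measurable_fun setT f ->
  (forall y, 0 <= f y)%E -> (gint s (tup x0) f = \int[P]_y f y)%E.

(** The change of mean applied to the constant 1. *)
Lemma integral_tuple_ratio (m : N.-tuple R) :
  (\int[P]_y (tuple_ratio s (tup x0) m y)%:E = 1)%E.
Proof.
have m1 : measurable_fun [set: N.-tuple R] (fun=> 1%E : \bar R) by [].
have := gint_change_mean (tup x0) m s_neq0 m1 (fun=> lee01).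
have [Q HQ] := gint_probability s m.
have Q1 : (\int[Q]_y 1 = 1 :> \bar R)%E.
  by rewrite integral_cst//= mul1e; exact: probability_setT.
rewrite HQ// Q1 HP//.
- by under eq_integral do rewrite mul1e; move=> <-.
- apply: emeasurable_funM => //.
  by apply/measurable_EFinP; exact: measurable_tuple_ratio.
- by move=> y; rewrite mul1e lee_fin tuple_ratio_ge0.
Qed.

Definition psi_fun x (y : N.-tuple R) := psi s x0 x (rowt y).
Definition psi_der_fun k x (y : N.-tuple R) := psi_der k x (rowt y).

Lemma measurable_psi_fun x : measurable_fun setT (psi_fun x).
Proof.
rewrite (_ : psi_fun x = fun y => psi_der [ffun=> 0%N] x (rowt y)).
  exact: measurable_psi_der.
by apply/funext => y; rewrite /psi_fun psi_derE.
Qed.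

Lemma integral_psi_psi x z :
  (\int[P]_y (psi_fun x y * psi_fun z y)%:E = (expR (dotv x z))%:E)%E.
Proof.
under eq_integral do rewrite psi_psi EFinM.
rewrite ge0_integralZl//.
- by rewrite integral_tuple_ratio mule1.
- by apply/measurable_EFinP; exact: measurable_tuple_ratio.
- by move=> y _; rewrite lee_fin tuple_ratio_ge0.
Qed.

Lemma sqint_psi x : sqint P (psi_fun x).
Proof.
split; first exact: measurable_psi_fun.
apply/integrableP; split.
  by apply/measurable_EFinP/measurable_funX; exact: measurable_psi_fun.
under eq_integral do rewrite gee0_abs ?lee_fin ?sqr_ge0// expr2.
by rewrite integral_psi_psi ltry.
Qed.

Lemma ip_psi_psi x z : ip P (psi_fun x) (psi_fun z) = expR (dotv x z).
Proof. by rewrite /ip /Rintegral integral_psi_psi. Qed.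

Lemma sqint_psi_dom B : sqint P (fun y => psi_dom B (rowt y)).
Proof.
by apply: sqint_sum => e; exact: sqint_psi.
Qed.

Lemma sqint_psi_der k x : sqint P (psi_der_fun k x).
Proof.
pose r := \sum_l `|x ord0 l|.
have r0 : 0 <= r by exact: sumr_ge0.
have [K K0 KP] := psi_der_bound k r0.
apply: (@le_sqint _ _ _ _ _ (fun y => K * psi_dom (r + 1) (rowt y))).
- exact: measurable_psi_der.
- move=> y; apply: KP => l; rewrite /r (bigD1 l)//= lerDl.
  exact: sumr_ge0.
- exact/sqintZ/sqint_psi_dom.
Qed.

(** Differentiation under the integral; the dominating function is a product of two
    square-integrable ones, h and a multiple of [psi_dom]. *)
Lemma pder_ip_psi_der (h : N.-tuple R -> R) k l x : sqint P h ->
  pder l (fun x => ip P h (psi_der_fun k x)) x =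
  ip P h (psi_der_fun (incr_index k l) x).
Proof.
move=> sh; apply: pder_coord.
pose f (t : R) (y : N.-tuple R) := h y * psi_der_fun k (set_coord l x t) y.
pose a := x ord0 l.
have df (t : R) y : is_derive t 1 (f ^~ y)
    (h y * psi_der_fun (incr_index k l) (set_coord l x t) y).
  apply: is_deriveZ.
  apply: (@is_derive_prod_coord _ _ l
    (fun i => hermite_exp ((rowt y ord0 i + x0 ord0 i) / s))) => i j u.
  exact: is_derive_hermite_exp.
have d1f t y : partial1of2 f t y =
    h y * psi_der_fun (incr_index k l) (set_coord l x t) y.
  by rewrite partial1of2E (@derive_val _ _ _ _ _ _ _ (df t y)).
(* Bounds all coordinates of x while the l-th one moves by less than 1. *)
pose r := \sum_i `|x ord0 i| + 1.
have r0 : 0 <= r by rewrite addr_ge0// sumr_ge0.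
have [K K0 KP] := psi_der_bound (incr_index k l) r0.
pose G y := `|h y * (K * psi_dom (r + 1) (rowt y))|.
have sK : sqint P (fun y => K * psi_dom (r + 1) (rowt y)).
  exact/sqintZ/sqint_psi_dom.
have Ia : `]a - 1, a + 1[%classic a by rewrite /= in_itv/=; lra.
have intf t : `]a - 1, a + 1[%classic t -> P.-integrable setT (EFin \o f t).
  by move=> _; exact: (integrable_sqintM sh (sqint_psi_der k (set_coord l x t))).
have der t y : `]a - 1, a + 1[%classic t -> setT y -> derivable (f ^~ y) t 1.
  by move=> _ _; exact: (@ex_derive _ _ _ _ _ _ _ (df t y)).
have intG : P.-integrable setT (EFin \o G).
  exact: (integrable_norm (integrable_sqintM sh sK)).
have Gub t y : `]a - 1, a + 1[%classic t -> setT y -> `|partial1of2 f t y| <= G y.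
  rewrite /= in_itv/= => /andP[t1 t2] _; rewrite d1f /G normrM [leRHS]normrM.
  apply: ler_wpM2l => //; apply: le_trans (ler_norm _); apply: KP => i.
  rewrite set_coordE; case: ifPn => _.
    have : `|t| <= `|a| + 1.
      by rewrite -[t](subrK a) addrC (le_trans (ler_normD _ _))// lerD2l ler_norml; lra.
    move=> /le_trans; apply; rewrite /r lerD2r /a (bigD1 l)//= lerDl.
    exact: sumr_ge0.
  rewrite /r (bigD1 i)//= -addrA lerDl addr_ge0//.
  exact: sumr_ge0.
have G0 y : 0 <= G y by exact: normr_ge0.
have dF := derivable_under_integral measurableT Ia intf der G0 intG Gub.
have vF := differentiation_under_integral measurableT Ia intf der G0 intG Gub.
split; first exact: dF.
rewrite -derive1E; transitivity (\int[P]_(y in setT) partial1of2 f a y); first exact: vF.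
by apply: eq_Rintegral => y _; rewrite d1f set_coord_id.
Qed.

Lemma mder_ip_psi (h : N.-tuple R -> R) p : sqint P h ->
  mder p (fun x => ip P h (psi_fun x)) 0 = ip P h (psi_der_fun p 0).
Proof.
move=> sh.
rewrite (_ : (fun x => _) = (fun x => ip P h (psi_der_fun [ffun=> 0%N] x))).
  rewrite (@mder_family _ _ (fun k x => ip P h (psi_der_fun k x)))//.
  by move=> k l x; exact: pder_ip_psi_der.
apply/funext => x; congr ip; apply/funext => y.
by rewrite /psi_fun psi_derE.
Qed.

Lemma ip_psi_psi_der x p : ip P (psi_fun x) (psi_der_fun p 0) = mpow x p.
Proof.
rewrite -mder_ip_psi; last exact: sqint_psi.
rewrite -[RHS]mder_expR_dotv; congr (mder _ _ _).
apply/funext => z; rewrite ip_psi_psi; congr expR.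
by apply: eq_bigr => l _; rewrite mulrC.
Qed.

(** The inner product of the q-th derivative with [psi_fun] at z is the monomial z^q;
    differentiating it once more at 0 gives the claim. *)
Lemma ip_psi_der_psi_der p q :
  ip P (psi_der_fun q 0) (psi_der_fun p 0) = (p == q)%:R * (mfact p)%:R.
Proof.
rewrite -mder_ip_psi; last exact: sqint_psi_der.
rewrite -mder_monomial; congr (mder _ _ _).
by apply/funext => z; rewrite ipC ip_psi_psi_der.
Qed.

End gaussian_kernel.

(** * Unordered sums and Parseval *)

Section unordered_sums.
Context (R : realType) (I : choiceType).
Implicit Types (D : set I) (u : I -> R).

(** Links the difference of positive and negative parts to convergence along finite sets; absolute
    summability rules out infinity minus infinity. *)
Lemma ssum_limit D u (r : R) :
  (\esum_(i in D) (`|u i|)%:E < +oo)%E ->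
  (forall e, 0 < e -> exists X0, [/\ uniq X0, (forall i, i \in X0 -> D i) &
     forall X, uniq X -> (forall i, i \in X -> D i) -> {subset X0 <= X} ->
       `|\sum_(i <- X) u i - r| <= e]) ->
  (ssum D u = r%:E)%E.
Proof.
move=> fin lim.
pose up i := Num.max (u i) 0; pose un i := Num.max (- u i) 0.
have fin_part v : (forall i, 0 <= v i) -> (forall i, v i <= `|u i|) ->
    (\esum_(i in D) (v i)%:E)%E \is a fin_num.
  move=> v0 vu; rewrite ge0_fin_numE; last first.
    by apply: esum_ge0 => i _; rewrite lee_fin.
  by apply: le_lt_trans fin; apply: le_esum => i _; rewrite lee_fin.
have up0 i : 0 <= up i by rewrite le_max lexx orbT.
have un0 i : 0 <= un i by rewrite le_max lexx orbT.
have fp : (\esum_(i in D) (up i)%:E)%E \is a fin_num.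
  by apply: fin_part => // i; rewrite ge_max normr_ge0 ler_norm.
have fn : (\esum_(i in D) (un i)%:E)%E \is a fin_num.
  by apply: fin_part => // i; rewrite ge_max normr_ge0 -normrN ler_norm.
rewrite /ssum -/up -/un -(fineK fp) -(fineK fn) -EFinB; congr EFin.
set A := fine _; set B := fine _.
apply/eqP; rewrite -subr_eq0 -normr_le0; apply/ler_addgt0Pr => e e0; rewrite add0r.
have e3 : 0 < e / 3 by rewrite divr_gt0.
have [X0 [uX0 X0D X0P]] := lim _ e3.
have [Xp [uXp XpD]] := esum_adherent e3 fp.
have [Xn [uXn XnD]] := esum_adherent e3 fn.
rewrite -(fineK fp) -(fineK fn) -!EFinB !lte_fin -/A -/B => ltB ltA.
(* One list that is good for the signed sum and for both parts, each within e / 3. *)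
pose X := undup (X0 ++ Xp ++ Xn).
have uX : uniq X by exact: undup_uniq.
have XD i : i \in X -> D i.
  by rewrite mem_undup !mem_cat => /or3P[/X0D|/XpD|/XnD].
have sub0 : {subset X0 <= X} by move=> i iX; rewrite mem_undup mem_cat iX.
have subp : {subset Xp <= X} by move=> i iX; rewrite mem_undup !mem_cat iX orbT.
have subn : {subset Xn <= X} by move=> i iX; rewrite mem_undup !mem_cat iX !orbT.
have := X0P X uX XD sub0.
have -> : \sum_(i <- X) u i = \sum_(i <- X) up i - \sum_(i <- X) un i.
  rewrite -sumrB; apply: eq_bigr => i _; rewrite /up /un.
  by case: (lerP 0 (u i)) => ui; [rewrite max_r ?oppr_le0// subr0|
    rewrite max_l ?oppr_ge0 ?ltW// sub0r opprK].
have := ler_sum_uniq up0 uXp uX subp; have := ler_sum_uniq un0 uXn uX subn.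
have : \sum_(i <- X) up i <= A by rewrite -lee_fin fineK// ler_esum.
have : \sum_(i <- X) un i <= B by rewrite -lee_fin fineK// ler_esum.
rewrite !ler_norml; lra.
Qed.

End unordered_sums.

Section parseval.
Context d (T : measurableType d) (R : realType) (P : probability T R).
Variables (I : choiceType) (e : I -> T -> R).
Hypothesis se : forall i, sqint P (e i).
Hypothesis oe : forall i j, ip P (e i) (e j) = (i == j)%:R.

(** The last hypothesis places g in the closed span of the [e i] with i in D; h is arbitrary.
    Cauchy-Schwarz bounds h against the remainder of g. *)
Lemma ssum_parseval (D : set I) g h : sqint P g -> sqint P h ->
  (forall r, 0 < r -> exists X, [/\ uniq X, (forall i, i \in X -> D i) &
     ip P g g - r < \sum_(i <- X) ip P g (e i) ^+ 2]) ->
  ssum D (fun i => ip P h (e i) * ip P g (e i)) = (ip P h g)%:E.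
Proof.
move=> sg sh full; apply: ssum_limit.
  apply: (@le_lt_trans _ _
    (\esum_(i in D) ((ip P h (e i) ^+ 2)%:E + (ip P g (e i) ^+ 2)%:E))%E).
    apply: le_esum => i _; rewrite -EFinD lee_fin normrM.
    rewrite -(real_normK (num_real (ip P h (e i)))).
    rewrite -(real_normK (num_real (ip P g (e i)))).
    have := normr_ge0 (ip P h (e i)); have := normr_ge0 (ip P g (e i)).
    by move: `|_| `|_| => a b; nra.
  rewrite esumD; try by move=> i _; rewrite lee_fin sqr_ge0.
  apply: (@le_lt_trans _ _ ((ip P h h)%:E + (ip P g g)%:E)%E).
    by apply: leeD; exact: bessel.
  by rewrite -EFinD ltry.
move=> r r0.
have h0 := ip_ge0 P h.
(* This tolerance times the squared norm of h is at most r^2; the added 1 avoids dividing by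
   zero. *)
have d0 : 0 < r ^+ 2 / (ip P h h + 1) by rewrite divr_gt0 ?exprn_gt0//; lra.
have [X0 [uX0 X0D X0P]] := full _ d0.
exists X0; split => // X uX XD sub.
have sX : sqint P (osum e X (fun i => ip P g (e i))) by exact: sqint_osum.
have -> : \sum_(i <- X) ip P h (e i) * ip P g (e i) - ip P h g =
    - ip P h (g \- osum e X (fun i => ip P g (e i))).
  rewrite [ip P h (g \- _)]ipC ipBl// opprB (ipC P g h); congr (_ - _).
  by rewrite ip_osuml//; apply: eq_bigr => i _; rewrite mulrC (ipC P h).
rewrite normrN -ler_sqr ?nnegrE ?normr_ge0 ?(ltW r0)// real_normK ?num_real//.
apply: le_trans (ip_CauchySchwarz sh (sqintB sg sX)) _.
rewrite (ip_osum_dist se oe)//.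
have le := ler_sum_uniq (fun i => sqr_ge0 (ip P g (e i))) uX0 uX sub.
apply: (@le_trans _ _ (ip P h h * (r ^+ 2 / (ip P h h + 1)))).
  by apply: ler_wpM2l => //; lra.
rewrite mulrCA ler_piMr ?sqr_ge0// ler_pdivrMr; lra.
Qed.

End parseval.

Lemma cvg_prod_seq (R : realType) (I : Type) (r : seq I) (F : I -> nat -> R)
    (L : I -> R) :
  (forall i, F i @ \oo --> L i) ->
  (fun n => \prod_(i <- r) F i n) @ \oo --> \prod_(i <- r) L i.
Proof.
move=> FL; elim: r => [|i r IHr].
  by rewrite big_nil; under eq_fun do rewrite big_nil; exact: cvg_cst.
rewrite big_cons (_ : (fun n => _) = F i \* (fun n => \prod_(i <- r) F i n)).
  exact: cvgM.
by apply/funext => n; rewrite big_cons.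
Qed.

(** * Expansion of exp(x.x) over sparse multi-indices *)

Section sparse_exponential.
Context {R : realType} {N : nat}.
Implicit Types (x : 'rV[R]_N) (p : {ffun 'I_N -> nat}).

Lemma MI_card S p : MI N S p = (#|[pred l | p l != 0%N]| <= S)%N.
Proof.
rewrite /MI /=; congr (is_true (_ <= _)%N).
by apply: eq_card => l; apply/idP/idP => [/set_mem|] //= ?; exact: mem_set.
Qed.

Lemma XS_card S x : XS N S x = (#|[pred l | x ord0 l != 0%R]| <= S)%N.
Proof.
rewrite /XS /=; congr (is_true (_ <= _)%N).
by apply: eq_card => l; apply/idP/idP => [/set_mem|] //= ?; exact: mem_set.
Qed.

(** The support of p is too large to fit in that of x, so some factor is a positive power of 0. *)
Lemma mpow_notin_MI S x p : XS N S x -> ~ MI N S p -> mpow x p = 0.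
Proof.
rewrite XS_card MI_card => xS /negP; rewrite -ltnNge => pS.
have [/forallP sub|/forallPn[l]] :=
    boolP [forall l, (p l != 0%N) ==> (x ord0 l != 0)].
  have /(leq_trans pS) : (#|[pred l | p l != 0%N]| <= #|[pred l | x ord0 l != 0%R]|)%N.
    by apply: subset_leq_card; apply/fintype.subsetP => l; rewrite !inE;
      exact: implyP (sub l).
  by rewrite ltnNge xS.
rewrite negb_imply negbK => /andP[pl /eqP xl].
by rewrite /mpow (bigD1 l)//= xl expr0n (negbTE pl) mul0r.
Qed.

(** A product of truncated exponential series in the [x ord0 l ^+ 2] expands into a sum over the box
    of multi-indices below n, where terms outside [MI] vanish. *)
Lemma mpow_sqr_adherent S x (e : R) : XS N S x -> 0 < e ->
  exists X, [/\ uniq X, (forall p, p \in X -> MI N S p) &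
    expR (dotv x x) - e < \sum_(p <- X) (mpow x p) ^+ 2 / (mfact p)%:R].
Proof.
move=> xS e0.
pose F (l : 'I_N) n := series (exp_coeff (x ord0 l ^+ 2)) n.
have cF l : F l @ \oo --> expR (x ord0 l ^+ 2).
  exact: is_cvg_series_exp_coeff.
have cP : (fun n => \prod_(l < N) F l n) @ \oo --> expR (dotv x x).
  rewrite (_ : expR (dotv x x) = \prod_(l < N) expR (x ord0 l ^+ 2)).
    exact: cvg_prod_seq.
  by rewrite /dotv expR_sum; apply: eq_bigr => l _; rewrite expr2.
have lte : expR (dotv x x) - e < expR (dotv x x) by rewrite ltrBlDr ltrDl.
have [n _ /(_ n (leqnn n)) Hn] := cvgr_gt _ cP _ lte.
pose emb (f : {ffun 'I_N -> 'I_n}) : {ffun 'I_N -> nat} := [ffun l => val (f l)].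
have emb_inj : injective emb.
  move=> f g /ffunP fg; apply/ffunP => l; apply/val_inj.
  by have := fg l; rewrite !ffunE.
pose c p : R := (mpow x p) ^+ 2 / (mfact p)%:R.
exists [seq p <- map emb (enum {ffun 'I_N -> 'I_n}) | `[< MI N S p >] ]; split.
- by rewrite filter_uniq// map_inj_uniq// enum_uniq.
- by move=> p; rewrite mem_filter => /andP[/asboolP].
- rewrite big_filter big_mkcond big_map/= big_enum/=.
  apply: (lt_le_trans Hn); rewrite le_eqVlt; apply/orP; left; apply/eqP.
  have FE l : F l n = \sum_(j < n) exp_coeff (x ord0 l ^+ 2) j.
    by rewrite /F /series/= big_mkord.
  rewrite (eq_bigr _ (fun l _ => FE l)).
  rewrite bigA_distr_bigA/=; apply: eq_bigr => f _.
  transitivity (c (emb f)).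
    rewrite /c /mpow /mfact natr_prod -prodrXl -prodf_div.
    apply: eq_bigr => l _; rewrite /exp_coeff/= ffunE -!exprM mulnC.
    by [].
  case: asboolP => // nMI.
  by rewrite /c (mpow_notin_MI xS nMI) expr0n mul0r.
Qed.

End sparse_exponential.

(** * Locally minimum variance estimators *)

Lemma eq_ssum (R : realType) (I : choiceType) (D : set I) (u v : I -> R) :
  (forall i, D i -> u i = v i) -> ssum D u = ssum D v.
Proof. by move=> uv; congr (_ - _)%E; apply: eq_esum => i Di; rewrite uv. Qed.

Section lmv.
Context {R : realType} {N : nat}.
Variables (S : nat) (s : R) (x0 : 'rV[R]_N).
Hypothesis s0 : 0 < s.
Variable P : probability (N.-tuple R) R.
Hypothesis HP : forall f : N.-tuple R -> \bar R, measurable_fun setT f ->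
  (forall y, 0 <= f y)%E -> (gint s (tup x0) f = \int[P]_y f y)%E.
Implicit Types (p q : {ffun 'I_N -> nat}) (h : 'rV[R]_N -> R) (x : 'rV[R]_N).

Let s_neq0 : s != 0. Proof. by rewrite gt_eqF. Qed.

(** At 0 the derivative is a product of Hermite polynomials in (y + x0) / s times exp(- y.x0 / s^2);
    the square root normalises it. *)
Definition hermite_basis p (y : N.-tuple R) : R :=
  (Num.sqrt (mfact p)%:R)^-1 * psi_der_fun s x0 p 0 y.

Lemma mfact_gt0 p : 0 < (mfact p)%:R :> R.
Proof. by rewrite ltr0n prodn_gt0// => l; rewrite fact_gt0. Qed.

Lemma sqint_hermite_basis p : sqint P (hermite_basis p).
Proof. exact/sqintZ/sqint_psi_der. Qed.

Lemma ip_hermite_basis p q :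
  ip P (hermite_basis p) (hermite_basis q) = (p == q)%:R.
Proof.
have sd r := sqint_psi_der s0 HP r 0.
rewrite ipZl//; last exact: sqint_hermite_basis.
rewrite ipC ipZl// ip_psi_der_psi_der// eq_sym.
have [->|_] := eqVneq p q; last by rewrite mul0r !mulr0.
rewrite mul1r mulrA -invfM -expr2 sqr_sqrtr ?mulVf ?gt_eqF ?mfact_gt0//.
Qed.

Lemma ip_psi_hermite_basis x p :
  ip P (psi_fun s x0 x) (hermite_basis p) = mpow x p / Num.sqrt (mfact p)%:R.
Proof.
rewrite ipC ipZl; [|exact: sqint_psi_der|exact: sqint_psi].
by rewrite ipC ip_psi_psi_der// mulrC.
Qed.

(** Parseval with g the kernel at a sparse x, whose norm is exhausted by the indices in [MI]. *)
Lemma ssum_ip_psi (f : N.-tuple R -> R) x : sqint P f -> XS N S x ->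
  ssum (MI N S) (fun p => ip P f (hermite_basis p) / Num.sqrt (mfact p)%:R *
    mpow x p) = (ip P f (psi_fun s x0 x))%:E.
Proof.
move=> sf xS.
rewrite -(ssum_parseval sqint_hermite_basis ip_hermite_basis (D := MI N S))//.
- apply: eq_ssum => p _; rewrite ip_psi_hermite_basis.
  by rewrite -!mulrA [_^-1 * _]mulrC.
- exact: sqint_psi.
move=> r r0; have [X [uX XD lt]] := mpow_sqr_adherent xS r0.
exists X; split => //; rewrite ip_psi_psi//; apply: (lt_le_trans lt).
rewrite le_eqVlt; apply/orP; left; apply/eqP; apply: eq_bigr => p _.
by rewrite ip_psi_hermite_basis exprMn exprVn sqr_sqrtr// ltW// mfact_gt0.
Qed.

(** Brings all means to the single measure P. Positive and negative parts are treated separately, so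
    no integrability is assumed. *)
Lemma Ex_ratio h x : estimator h ->
  Ex s x h = (\int[P]_y (h (rowt y) * tuple_ratio s (tup x0) (tup x) y)%:E)%E.
Proof.
move=> mh; set f := fun y : N.-tuple R => _.
have mr := measurable_tuple_ratio s (tup x0) (tup x).
have part (g : 'rV[R]_N -> R) : measurable_fun setT (fun y : N.-tuple R => g (rowt y)) ->
    (gint s (tup x) (fun y => (Num.max (g (rowt y)) 0)%:E) =
     \int[P]_y (Num.max (g (rowt y) * tuple_ratio s (tup x0) (tup x) y) 0)%:E)%E.
  move=> mg.
  have mM : measurable_fun setT (fun y : N.-tuple R => (Num.max (g (rowt y)) 0)%:E).
    by apply/measurable_EFinP; exact: measurable_maxr.
  have M0 (y : N.-tuple R) : (0 <= (Num.max (g (rowt y)) 0)%:E)%E.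
    by rewrite lee_fin le_max lexx orbT.
  rewrite (gint_change_mean (tup x0))// HP.
  - apply: eq_integral => y _; rewrite -EFinM; congr EFin.
    by rewrite maxr_pMl ?tuple_ratio_ge0// mul0r.
  - by apply: emeasurable_funM => //; apply/measurable_EFinP.
  - by move=> y; rewrite mule_ge0// lee_fin tuple_ratio_ge0.
rewrite [RHS]integralE /Ex part// (part (fun y => - h y)); last first.
  exact: measurable_funN.
congr (_ - _)%E; apply: eq_integral => y _; rewrite ?funeposE ?funenegE /f.
  by rewrite -EFin_max.
by rewrite -EFinN -EFin_max mulNr.
Qed.

Lemma tuple_ratio_id n (m y : n.-tuple R) : tuple_ratio s m m y = 1.
Proof.
rewrite /tuple_ratio big1// => i _.
by rewrite /gauss_ratio !subrr mulr0 !mul0r subrr expR0.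
Qed.

Lemma Ex_x0 h : estimator h -> Ex s x0 h = (\int[P]_y (h (rowt y))%:E)%E.
Proof.
by move=> mh; rewrite Ex_ratio//; apply: eq_integral => y _; rewrite tuple_ratio_id mulr1.
Qed.

Lemma Ex_psi h x : sqint P (h \o rowt) ->
  Ex s x h = ((nu s x0 x)^-1 * ip P (h \o rowt) (psi_fun s x0 (s^-1 *: x)))%:E.
Proof.
move=> sh; rewrite Ex_ratio; last exact: sh.1.
have spsi := sqint_psi s0 HP (s^-1 *: x).
rewrite -ipZl// EFin_ip//; last exact: sqintZ.
apply: eq_integral => y _; congr EFin; rewrite /psi_fun -psi_ratio//=.
by field; rewrite gt_eqF// expR_gt0.
Qed.

(** Works for any centring constant, in particular when [fine] returns its default value for a mean
    that is not finite. *)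
Lemma sqint_var h : estimator h -> (var s x0 h < +oo)%E -> sqint P (h \o rowt).
Proof.
rewrite /var; set k := fine _ => mh vh.
rewrite (_ : h \o rowt = (fun y => h (rowt y) - k) \+ cst k); last first.
  by apply/funext => y /=; rewrite subrK.
have mk : measurable_fun setT (fun y : N.-tuple R => h (rowt y) - k).
  exact: measurable_funB.
apply: sqintD; last exact: sqint_cst.
split => //; apply/integrableP; split.
  by apply/measurable_EFinP; exact: measurable_funX.
under eq_integral do rewrite gee0_abs ?lee_fin ?sqr_ge0//.
by move: vh; rewrite Ex_x0//; exact: measurable_funX.
Qed.

Lemma var_ip h (k : R) : sqint P (h \o rowt) -> Ex s x0 h = k%:E ->
  var s x0 h = (ip P (h \o rowt) (h \o rowt) - k ^+ 2)%:E.
Proof.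
move=> sh Ek; rewrite /var Ek/= Ex_x0; last first.
  by apply: measurable_funX; apply: measurable_funB => //; exact: sh.1.
have sk : sqint P (cst k) by exact: sqint_cst.
have s1 : sqint P (cst 1) by exact: sqint_cst.
transitivity (ip P (h \o rowt \- cst k) (h \o rowt \- cst k))%:E.
  by rewrite EFin_ip//; exact: sqintB.
congr EFin; rewrite ipBB//.
have h1 : ip P (cst 1) (h \o rowt) = k.
  apply: EFin_inj; rewrite EFin_ip// -Ek Ex_x0; last exact: sh.1.
  by apply: eq_integral => y _; rewrite /= mul1r.
have kZ : cst k = (fun y : N.-tuple R => k * cst 1 y).
  by apply/funext => y /=; rewrite mulr1.
have k1 : ip P (cst 1) (cst 1) = 1.
  apply: EFin_inj; rewrite EFin_ip//=.
  by rewrite integral_cst//= mulr1 mul1e; exact: probability_setT.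
have -> : ip P (h \o rowt) (cst k) = k * k by rewrite ipC kZ ipZl// h1.
have -> : ip P (cst k) (cst k) = k * k.
  by rewrite {1}kZ ipZl// ipC kZ ipZl// k1 mulr1.
ring.
Qed.

(** Unbiasedness for [gam] on [XS], phrased in the Hilbert space of P alone. *)
Definition reproduces (gam : 'rV[R]_N -> R) (f : N.-tuple R -> R) :=
  forall x, XS N S x -> gam x = (nu s x0 x)^-1 * ip P f (psi_fun s x0 (s^-1 *: x)).

Lemma admissibleP g c h : admissible S s g c x0 h <->
  sqint P (h \o rowt) /\ reproduces (fun x => c x + g x) (h \o rowt).
Proof.
split=> [[mh vh Eh]|[sh rh]].
  have sh := sqint_var mh vh; split => // x xS.
  by apply: EFin_inj; rewrite -Ex_psi// Eh.
split; first exact: sh.1.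
  by rewrite (var_ip sh (Ex_psi x0 sh)) ltry.
by move=> x xS; rewrite Ex_psi// -rh.
Qed.

(** The product of [gam] and [nu] at [s *: x] is the inner product of f with the kernel, but only
    for sparse x. For p in [MI] the points relevant to [mder_local] are sparse. *)
Lemma acoef_ip gam (f : N.-tuple R -> R) p : sqint P f -> reproduces gam f ->
  MI N S p -> acoef s gam x0 p = ip P f (hermite_basis p).
Proof.
move=> sf rf; rewrite MI_card => pS.
rewrite ipC ipZl//; last exact: sqint_psi_der.
rewrite ipC -mder_ip_psi// /acoef; congr (_ * _).
apply: mder_local => x xp.
have xS : XS N S (s *: x).
  rewrite XS_card; apply: leq_trans pS; apply: subset_leq_card.
  apply/fintype.subsetP => l; rewrite !inE mxE; apply: contra => /eqP pl.
  by rewrite xp// mulr0.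
rewrite rf// scalerA mulVf// scale1r mulrC mulrA divff ?mul1r//.
by rewrite gt_eqF// expR_gt0.
Qed.

Lemma lmv_termE gam (f : N.-tuple R -> R) p (y : N.-tuple R) : sqint P f ->
  reproduces gam f -> MI N S p ->
  lmv_term s gam x0 p (rowt y) = ip P f (hermite_basis p) * hermite_basis p y.
Proof.
move=> sf rf pS; rewrite /lmv_term (acoef_ip sf rf pS) mder_psi//.
by rewrite -mulrA.
Qed.

Definition representation gam (a : {ffun 'I_N -> nat} -> R) :=
  l2 (MI N S) a /\
  forall x, XS N S x ->
    ((gam x)%:E = ((nu s x0 x)^-1)%R%:E *
     ssum (MI N S) (fun p => (a p / Num.sqrt (mfact p)%:R * mpow (s^-1 *: x) p)%R))%E.

Lemma XS_scale (k : R) x : XS N S x -> XS N S (k *: x).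
Proof.
rewrite !XS_card; apply: leq_trans; apply: subset_leq_card.
apply/fintype.subsetP => l; rewrite !inE mxE; apply: contra => /eqP ->.
by rewrite mulr0.
Qed.

Lemma reproduces_representation gam (f : N.-tuple R -> R) : sqint P f ->
  reproduces gam f -> representation gam (fun p => ip P f (hermite_basis p)).
Proof.
move=> sf rf; split.
  apply: le_lt_trans (bessel sqint_hermite_basis ip_hermite_basis _ sf) _.
  exact: ltry.
move=> x xS; rewrite ssum_ip_psi//; last exact: XS_scale.
by rewrite -EFinM -rf.
Qed.

(** Riesz-Fischer synthesises f from a, and [ssum_ip_psi] shows that only its coefficients in [MI]
    matter on [XS]. *)
Lemma representation_reproduces gam a : representation gam a ->
  exists f, [/\ sqint P f, reproduces gam f,
    (forall p, MI N S p -> ip P f (hermite_basis p) = a p) &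
    (\esum_(p in MI N S) (a p ^+ 2)%:E = (ip P f f)%:E)%E].
Proof.
move=> [l2a ra].
have [f [sf fa nf]] := riesz_fischer sqint_hermite_basis ip_hermite_basis l2a.
exists f; split => // x xS; apply: EFin_inj; rewrite ra// EFinM.
rewrite -ssum_ip_psi//; last exact: XS_scale.
by congr (_ * _)%E; apply: eq_ssum => p pS; rewrite fa.
Qed.

Lemma representation_acoef gam a p : representation gam a -> MI N S p ->
  a p = acoef s gam x0 p.
Proof.
move=> /representation_reproduces[f [sf rf fa _]] pS.
by rewrite -fa// (acoef_ip sf rf pS).
Qed.

Lemma tupK : cancel (@rowt R N) (@tup R N).
Proof. by move=> y; apply: eq_from_tnth => i; rewrite tnth_mktuple mxE. Qed.

Lemma validP g c : valid S s g c x0 <->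
  exists f, sqint P f /\ reproduces (fun x => c x + g x) f.
Proof.
split=> [[h /admissibleP[sh rh]]|[f [sf rf]]]; first by exists (h \o rowt).
exists (f \o @tup R N); apply/admissibleP.
suff -> : (f \o @tup R N) \o rowt = f by [].
by apply/funext => y /=; rewrite tupK.
Qed.

Hypothesis x0S : XS N S x0.

(** Since x0 is itself in [XS], the mean at x0 is prescribed, and minimising the variance amounts to
    minimising the norm. *)
Lemma var_admissible g c h : admissible S s g c x0 h ->
  var s x0 h = (ip P (h \o rowt) (h \o rowt) - (c x0 + g x0) ^+ 2)%:E.
Proof. by move=> ah; have [_ _ Eh] := ah; have [sh _] := (admissibleP g c h).1 ah;
  apply: var_ip => //; exact: Eh. Qed.

(** Resynthesising the coefficients in [MI] of any representer drops its part orthogonal to these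
    basis elements and keeps the means on [XS]. *)
Lemma minimum_norm_admissible g c : valid S s g c x0 ->
  exists2 h, admissible S s g c x0 h &
    (\esum_(p in MI N S) (acoef s (fun x => c x + g x) x0 p ^+ 2)%:E =
     (ip P (h \o rowt) (h \o rowt))%:E)%E.
Proof.
move=> /validP[f0 [sf0 rf0]].
have [f [sf rf fa nf]] := representation_reproduces
  (reproduces_representation sf0 rf0).
have fE : (f \o @tup R N) \o rowt = f by apply/funext => y /=; rewrite tupK.
exists (f \o @tup R N); first by apply/admissibleP; rewrite fE.
rewrite fE -nf; apply: eq_esum => p pS.
by rewrite (acoef_ip sf0 rf0 pS).
Qed.

Lemma acoef_bessel g c h : admissible S s g c x0 h ->
  (\esum_(p in MI N S) (acoef s (fun x => c x + g x) x0 p ^+ 2)%:E <=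
   (ip P (h \o rowt) (h \o rowt))%:E)%E.
Proof.
move=> /admissibleP[sh rh].
apply: le_trans (bessel sqint_hermite_basis ip_hermite_basis (MI N S) sh).
by apply: le_esum => p pS; rewrite (acoef_ip sh rh pS).
Qed.

Lemma Mmin_esum g c : valid S s g c x0 ->
  Mmin S s g c x0 =
  (\esum_(p in MI N S) (acoef s (fun x => (c x + g x)%R) x0 p ^+ 2)%:E -
   ((c x0 + g x0) ^+ 2)%:E)%E.
Proof.
move=> /minimum_norm_admissible[h ah nh]; apply/eqP; rewrite eq_le; apply/andP; split.
  by rewrite nh -EFinB -var_admissible//; apply: ereal_inf_lbound; exists h.
apply: le_ereal_inf_tmp => _ [h' ah' <-]; rewrite (var_admissible ah').
by rewrite EFinB; apply: leeB => //; exact: acoef_bessel.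
Qed.

(** Optimality forces equality in Bessel's inequality. *)
Lemma LMV_norm g c h : LMV S s g c x0 h ->
  (\esum_(p in MI N S) (acoef s (fun x => (c x + g x)%R) x0 p ^+ 2)%:E =
   (ip P (h \o rowt) (h \o rowt))%:E)%E.
Proof.
move=> [ah vh].
have vl : valid S s g c x0 by exists h.
have [h' ah' nh'] := minimum_norm_admissible vl.
move: vh; rewrite (Mmin_esum vl) (var_admissible ah) nh' -EFinB => -[/eqP].
by rewrite (inj_eq (addIr _)) => /eqP ->.
Qed.

(** By that equality, the squared distance from h to a finite partial sum is the missing part of the
    total, which is below e once F contains a near-optimal list. *)
Lemma LMV_expansion g c h (e : R) : LMV S s g c x0 h -> 0 < e ->
  exists F0 : set {ffun 'I_N -> nat},
    [/\ finite_set F0, F0 `<=` MI N S &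
     forall F, finite_set F -> F0 `<=` F -> F `<=` MI N S ->
      (Ex s x0 (fun y => ((h y - \sum_(p \in F)
          lmv_term s (fun x => c x + g x) x0 p y) ^+ 2)%R) < e%:E)%E].
Proof.
move=> lh e0; have [ah _] := lh.
have [sh rh] := (admissibleP g c h).1 ah.
pose a p := ip P (h \o rowt) (hermite_basis p).
have nh : (\esum_(p in MI N S) (a p ^+ 2)%:E = (ip P (h \o rowt) (h \o rowt))%:E)%E.
  by rewrite -(LMV_norm lh); apply: eq_esum => p pS; rewrite (acoef_ip sh rh pS).
have fin : (\esum_(p in MI N S) (a p ^+ 2)%:E)%E \is a fin_num by rewrite nh.
have [X0 [uX0 X0D]] := esum_adherent e0 fin.
rewrite nh -EFinB lte_fin => lt.
exists [set` X0]; split; [exact: finite_seq|by move=> p; exact: X0D|].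
move=> F finF X0F FD.
pose X := finmap.enum_fset (fset_set F).
have uX : uniq X by exact: finmap.fset_uniq.
have XF p : p \in X -> F p by rewrite in_fset_set// inE.
have hX (y : N.-tuple R) : h (rowt y) - \sum_(p \in F)
    lmv_term s (fun x => c x + g x) x0 p (rowt y) =
    (h \o rowt \- osum hermite_basis X a) y.
  rewrite /= fsbig_finite//; congr (_ - _); apply: eq_big_seq => p pX.
  by rewrite (lmv_termE y sh rh)//; exact/FD/XF.
have sX : sqint P (osum hermite_basis X a).
  by apply: sqint_osum; exact: sqint_hermite_basis.
have sd := sqintB sh sX.
rewrite Ex_x0; last first.
  rewrite /estimator (_ : (fun y : N.-tuple R => _) =
    fun y => (h \o rowt \- osum hermite_basis X a) y ^+ 2).
    by apply: measurable_funX; exact: sd.1.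
  by apply/funext => y; rewrite hX.
under eq_integral do rewrite hX expr2.
rewrite -EFin_ip// (ip_osum_dist sqint_hermite_basis ip_hermite_basis)//.
rewrite lte_fin.
have := ler_sum_uniq (fun p => sqr_ge0 (a p)) uX0 uX.
have sub : {subset X0 <= X}.
  by move=> p pX; rewrite in_fset_set// inE; exact: X0F.
by move=> /(_ sub); rewrite -/a; lra.
Qed.

End lmv.

Theorem theorem10 (R : realType) (N S : nat) (s : R)
  (g : 'rV[R]_N -> R) (x0 : 'rV[R]_N) :
  (1 <= S <= N)%N -> 0 < s -> XS N S x0 ->
  forall c : 'rV[R]_N -> R,
  let gam := fun x => c x + g x in
  let rep := fun a : {ffun 'I_N -> nat} -> R =>
    l2 (MI N S) a /\
    forall x, XS N S x ->
      ((gam x)%:E =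
       ((nu s x0 x)^-1)%R%:E *
       ssum (MI N S) (fun p => (a p / Num.sqrt (mfact p)%:R * mpow (s^-1 *: x) p)%R))%E in
  (* (1) validity <-> representation, with a unique coefficient sequence *)
  (valid S s g c x0 <-> exists a, rep a) /\
  (forall a b, rep a -> rep b -> forall p, MI N S p -> a p = b p) /\
  (* (2) minimum variance and LMV estimator *)
  (valid S s g c x0 ->
     (Mmin S s g c x0 =
        (\esum_(p in MI N S) ((acoef s gam x0 p) ^+ 2)%:E - ((gam x0) ^+ 2)%:E)%E) /\
     (exists h, LMV S s g c x0 h) /\
     (forall h, LMV S s g c x0 h ->
        forall e : R, 0 < e ->
        exists F0 : set {ffun 'I_N -> nat},
          [/\ finite_set F0, F0 `<=` MI N S &
          forall F : set {ffun 'I_N -> nat},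
            finite_set F -> F0 `<=` F -> F `<=` MI N S ->
            (Ex s x0 (fun y => ((h y - \sum_(p \in F) lmv_term s gam x0 p y) ^+ 2)%R)
               < e%:E)%E])).
Proof.
move=> _ s0 x0S c gam rep.
(* All L2 arguments refer to this one measure, the law of the observation at x0. *)
have [P HP] := gint_probability s (tup x0).
split; [|split].
- split=> [/(validP S s0 HP)[f [sf rf]]|[a /(representation_reproduces s0 HP)]].
    by exists (fun p => ip P f (hermite_basis s x0 p));
      exact: (reproduces_representation s0 HP).
  by move=> [f [sf rf _ _]]; apply/(validP S s0 HP); exists f.
- move=> a b ra rb p pS.
  by rewrite (representation_acoef s0 HP ra pS) (representation_acoef s0 HP rb pS).
- move=> vl; have Mm := Mmin_esum s0 HP x0S vl; split; first exact: Mm.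
  split; last by move=> h lh e e0; exact: (LMV_expansion s0 HP x0S lh e0).
  have [h ah nh] := minimum_norm_admissible s0 HP vl.
  exists h; split => //.
  by rewrite Mm (var_admissible s0 HP x0S ah) nh EFinB.
Qed.
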